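(* Let $\mathfrak{g}=\mathfrak{sl}_{m|n}$ with $m\neq n$, or $\mathfrak{g}=\mathfrak{psl}_{m|m}$ (with $n=m$). Let $f\in\mathfrak{g}_{\bar0}$ be a nilpotent element encoded by a pair of partitions $(\alpha|\beta)$, $\alpha=(m_1^{\mu_1},\dots,m_t^{\mu_t})\vdash m$, $\beta=(m_1^{\nu_1},\dots,m_t^{\nu_t})\vdash n$. If $\mathfrak{g}^\natural$ is a reductive Lie algebra, then $\mathrm{mult}(\mathbb{C}\otimes\mathrm{adj})=|\{m_i: m_i>1\}|$. In particular, $\mathrm{mult}(\mathbb{C}\otimes\mathrm{adj})=1$ if and only if $f$ is encoded by one of the following pairs (with $q>1$): (1) $(q^l,1^r\,|\,0)$ with $m=ql+r$, $n=0$; or $(0\,|\,q^l,1^r)$ with $n=ql+r$, $m=0$; (2) $(q^l\,|\,1^n)$ with $m=ql$; or $(1^m\,|\,q^l)$ with $n=ql$.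
   Context: Let $(e,x,f)\subset\mathfrak{g}_{\bar0}$ be an $\mathfrak{sl}_2$-triple containing $f$, with span $\mathfrak{s}$, and let $\mathfrak{g}^\natural$ be the centralizer of $\mathfrak{s}$ in $\mathfrak{g}$. The encoding means: the $m_i$ are distinct positive integers, $\mu_i,\nu_i\ge0$, $\mu_i+\nu_i>0$, and as an $\mathfrak{s}$-module the even part $\mathbb{C}^m$ (resp. odd part $\mathbb{C}^n$) of $\mathbb{C}^{m|n}$ decomposes as $\bigoplus_iV(m_i-1)^{\oplus\mu_i}$ (resp. $\bigoplus_iV(m_i-1)^{\oplus\nu_i}$), with $V(p)$ the irreducible $\mathfrak{sl}_2$-module of dimension $p+1$ (for $\mathfrak{psl}_{m|m}$ one uses a lift of $\mathfrak{s}$ to $\mathfrak{sl}_{m|m}$). $\mathbb{C}$ denotes the trivial representation of $\mathfrak{g}^\natural$, $\mathrm{adj}=V(2)$ the adjoint representation of $\mathfrak{s}\cong\mathfrak{sl}_2$, and $\mathrm{mult}(\mathbb{C}\otimes\mathrm{adj})$ its multiplicity in $\mathfrak{g}$ as a $\mathfrak{g}^\natural\oplus\mathfrak{s}$-module. *)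

(* Defs.v *)
From HB Require Import structures.
From mathcomp Require Import all_boot all_order all_algebra.
From mathcomp Require Import boolp reals.
From mathcomp Require Import complex.
From mathcomp Require Import ring.

Set Implicit Arguments.
Unset Strict Implicit.
Unset Printing Implicit Defensive.

Import GRing.Theory.
Local Open Scope ring_scope.

(* Finite-dimensional Lie superalgebras; [lpart false] is the even part and
   [lpart true] the odd part.  These axioms are the usual ones when 6 is
   invertible in F, in particular over the complex numbers. *)
Record lieSuperalgebra (F : fieldType) := LieSuperalgebra {
  lcarrier :> vectType F;
  lpart : bool -> {vspace lcarrier};
  lbr : lcarrier -> lcarrier -> lcarrier;
  lbr_linearr : forall a, linear (lbr a);
  lbr_linearl : forall b, linear (lbr^~ b);
  lpartD : (lpart false + lpart true = fullv)%VS;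
  lpartI : (lpart false :&: lpart true = 0)%VS;
  lbr_part : forall i j a b,
    a \in lpart i -> b \in lpart j -> lbr a b \in lpart (i (+) j);
  lbrC : forall i j a b, a \in lpart i -> b \in lpart j ->
    lbr a b = - ((-1) ^+ (i && j) *: lbr b a);
  lbr_jacobi : forall i j k a b c,
    a \in lpart i -> b \in lpart j -> c \in lpart k ->
    lbr a (lbr b c) = lbr (lbr a b) c + (-1) ^+ (i && j) *: lbr b (lbr a c)
}.

Arguments lpart {F l}.
Arguments lbr {F l}.

Section Bracket.
Variables (F : fieldType) (L : lieSuperalgebra F).

HB.instance Definition _ (a : L) :=
  GRing.isLinear.Build F L L *:%R (@lbr F L a) (@lbr_linearr F L a).

Definition lbr_flip (b a : L) : L := lbr a b.
HB.instance Definition _ (b : L) :=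
  GRing.isLinear.Build F L L *:%R (lbr_flip b) (@lbr_linearl F L b).

Lemma lbrDr (a b c : L) : lbr a (b + c) = lbr a b + lbr a c.
Proof. exact: linearD. Qed.
Lemma lbrDl (a b c : L) : lbr (a + b) c = lbr a c + lbr b c.
Proof. exact: (linearD (lbr_flip c)). Qed.
Lemma lbrZr (k : F) (a b : L) : lbr a (k *: b) = k *: lbr a b.
Proof. exact: linearZ. Qed.
Lemma lbrZl (k : F) (a b : L) : lbr (k *: a) b = k *: lbr a b.
Proof. exact: (linearZ_LR (lbr_flip b)). Qed.
Lemma lbrBr (a b c : L) : lbr a (b - c) = lbr a b - lbr a c.
Proof. exact: linearB. Qed.
Lemma lbrBl (a b c : L) : lbr (a - b) c = lbr a c - lbr b c.
Proof. exact: (linearB (lbr_flip c)). Qed.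

(* U is the direct sum of its even and odd parts. *)
Definition graded (U : {vspace L}) : Prop :=
  (U :&: lpart false + U :&: lpart true = U)%VS.

Definition lclosed (U V W : {vspace L}) : Prop :=
  forall a b, a \in U -> b \in V -> lbr a b \in W.

End Bracket.

Section SubAlgebra.
Variables (F : fieldType) (L : lieSuperalgebra F) (U : {vspace L}).
Hypotheses (grU : graded U) (clU : lclosed U U U).

Definition sub_part i : {vspace subvs_of U} :=
  (linfun (vsval : subvs_of U -> L) @^-1: lpart i)%VS.
Definition sub_br (a b : subvs_of U) : subvs_of U :=
  vsproj U (lbr (vsval a) (vsval b)).

Lemma sub_partE i a : (a \in sub_part i) = (vsval a \in lpart i).
Proof. by rewrite -memv_preim lfunE. Qed.

Lemma sub_brE a b : vsval (sub_br a b) = lbr (vsval a) (vsval b).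
Proof. by rewrite vsprojK // clU ?subvsP. Qed.

Fact sub_br_linearr a : linear (sub_br a).
Proof. by move=> k u v; apply: val_inj; rewrite linearP /= !sub_brE !linearP. Qed.
Fact sub_br_linearl b : linear (sub_br^~ b).
Proof.
move=> k u v; apply: val_inj; rewrite linearP /= !sub_brE linearP /=.
exact: (linearP (lbr_flip (vsval b))).
Qed.
Fact sub_partD : (sub_part false + sub_part true = fullv)%VS.
Proof.
apply/vspaceP => u; rewrite memvf.
have: vsval u \in (U :&: lpart false + U :&: lpart true)%VS by rewrite grU subvsP.
case/memv_addP=> a /memv_capP[aU a0] [b /memv_capP[bU b1] uE].
apply/memv_addP; exists (vsproj U a); first by rewrite sub_partE vsprojK.
exists (vsproj U b); first by rewrite sub_partE vsprojK.
by apply: val_inj; rewrite linearD /= !vsprojK.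
Qed.
Fact sub_partI : (sub_part false :&: sub_part true = 0)%VS.
Proof.
apply/vspaceP=> u; rewrite memv_cap !sub_partE -memv_cap lpartI !memv0.
by rewrite -(inj_eq val_inj) linear0.
Qed.
Fact sub_br_part i j a b :
  a \in sub_part i -> b \in sub_part j -> sub_br a b \in sub_part (i (+) j).
Proof. by rewrite !sub_partE sub_brE; apply: lbr_part. Qed.
Fact sub_brC i j a b : a \in sub_part i -> b \in sub_part j ->
  sub_br a b = - ((-1) ^+ (i && j) *: sub_br b a).
Proof.
rewrite !sub_partE => ha hb; apply: val_inj.
by rewrite linearN linearZ /= !sub_brE (lbrC ha hb) scalerN.
Qed.
Fact sub_jacobi i j k a b c :
  a \in sub_part i -> b \in sub_part j -> c \in sub_part k ->
  sub_br a (sub_br b c) =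
    sub_br (sub_br a b) c + (-1) ^+ (i && j) *: sub_br b (sub_br a c).
Proof.
rewrite !sub_partE => ha hb hc; apply: val_inj.
by rewrite linearD linearZ /= !sub_brE; apply: lbr_jacobi ha hb hc.
Qed.

Definition subAlgebra : lieSuperalgebra F :=
  LieSuperalgebra sub_br_linearr sub_br_linearl sub_partD sub_partI
    sub_br_part sub_brC sub_jacobi.

End SubAlgebra.

(* The quotient of L by a graded ideal I, carried by the complement I^C, with
   [quo_proj] the canonical projection (see quo_proj_surj, quo_proj_ker and
   quo_projM). *)
Section Quotient.
Variables (F : fieldType) (L : lieSuperalgebra F) (I : {vspace L}).
Hypotheses (grI : graded I) (idl : lclosed fullv I I) (idr : lclosed I fullv I).

Definition quo_proj : 'Hom(L, subvs_of (I^C)%VS) :=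
  (linfun (vsproj (I^C)%VS) \o daddv_pi (I^C)%VS I)%VF.

Definition quo_part i : {vspace subvs_of (I^C)%VS} := (quo_proj @: lpart i)%VS.
Definition quo_br (a b : subvs_of (I^C)%VS) : subvs_of (I^C)%VS :=
  quo_proj (lbr (vsval a) (vsval b)).

Let capC0 : (I^C :&: I = 0)%VS. Proof. by rewrite capvC capv_compl. Qed.

Lemma quo_projE v : vsval (quo_proj v) = daddv_pi (I^C)%VS I v.
Proof. by rewrite comp_lfunE lfunE /= vsprojK ?memv_pi. Qed.

Lemma quo_projK a : quo_proj (vsval a) = a.
Proof. by apply: val_inj; rewrite /= quo_projE daddv_pi_id ?subvsP. Qed.

Lemma quo_proj_surj : limg quo_proj = fullv.
Proof.
apply/vspaceP=> a; rewrite memvf; apply/memv_imgP.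
by exists (vsval a); rewrite ?memvf ?quo_projK.
Qed.

Lemma quo_proj_sub v : v - vsval (quo_proj v) \in I.
Proof.
have vI : v \in (I^C + I)%VS by rewrite addvC addv_complf memvf.
rewrite quo_projE -{1}(daddv_pi_add capC0 vI) addrAC subrr add0r.
exact: memv_pi.
Qed.

Lemma quo_proj_eq0 v : (quo_proj v == 0) = (v \in I).
Proof.
apply/eqP/idP=> [v0|vI].
  by have := quo_proj_sub v; rewrite v0 linear0 addr0.
have: vsval (quo_proj v) \in (I^C :&: I)%VS.
  rewrite memv_cap subvsP -[vsval _](subKr v) memvB //; exact: quo_proj_sub.
by rewrite capC0 memv0 => /eqP vv; apply: val_inj; rewrite /= vv.
Qed.

Lemma quo_proj_ker : lker quo_proj = I.
Proof. by apply/vspaceP=> v; rewrite memv_ker quo_proj_eq0. Qed.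

Lemma quo_proj_eq u v : u - v \in I -> quo_proj u = quo_proj v.
Proof.
by rewrite -quo_proj_eq0 linearB subr_eq0 => /eqP.
Qed.

Lemma quo_projM u v : quo_proj (lbr u v) = quo_br (quo_proj u) (quo_proj v).
Proof.
apply: quo_proj_eq; set u' := vsval _; set v' := vsval _.
have -> : lbr u v - lbr u' v' = lbr (u - u') v + lbr u' (v - v').
  by rewrite lbrBl lbrBr addrA addrNK.
by apply: memvD; [apply: idr | apply: idl]; rewrite ?memvf ?quo_proj_sub.
Qed.

Lemma quo_partP i a :
  reflect (exists2 u, u \in lpart i & a = quo_proj u) (a \in quo_part i).
Proof. exact: memv_imgP. Qed.

Fact quo_br_linearr a : linear (quo_br a).
Proof. by move=> k u v; rewrite /quo_br !linearP. Qed.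
Fact quo_br_linearl b : linear (quo_br^~ b).
Proof.
move=> k u v; rewrite /quo_br -linearP; congr (quo_proj _); rewrite linearP /=.
exact: (linearP (lbr_flip (vsval b))).
Qed.
Fact quo_partD : (quo_part false + quo_part true = fullv)%VS.
Proof. by rewrite -limgD lpartD quo_proj_surj. Qed.
Fact quo_partI : (quo_part false :&: quo_part true = 0)%VS.
Proof.
apply/eqP; rewrite -subv0; apply/subvP=> w /memv_capP[].
case/quo_partP=> a a0 ->; case/quo_partP=> b b1 ab.
have: a - b \in I by rewrite -quo_proj_eq0 linearB /= ab subrr.
rewrite -{1}grI => /memv_addP[c /memv_capP[cI c0] [d /memv_capP[dI d1] abE]].
have: a - c \in (lpart false :&: lpart true)%VS.
  rewrite memv_cap memvB //= (_ : a - c = b + d) ?memvD //.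
  by apply/eqP; rewrite subr_eq addrAC -addrA -abE addrC subrK.
rewrite lpartI => ac0; have /subr0_eq -> : a - c = 0 by apply/eqP; rewrite -memv0.
by rewrite memv0 quo_proj_eq0.
Qed.
Fact quo_br_part i j a b :
  a \in quo_part i -> b \in quo_part j -> quo_br a b \in quo_part (i (+) j).
Proof.
move=> /quo_partP[u ui ->] /quo_partP[v vj ->]; rewrite -quo_projM.
by rewrite memv_img ?lbr_part.
Qed.
Fact quo_brC i j a b : a \in quo_part i -> b \in quo_part j ->
  quo_br a b = - ((-1) ^+ (i && j) *: quo_br b a).
Proof.
move=> /quo_partP[u ui ->] /quo_partP[v vj ->]; rewrite -!quo_projM.
by rewrite (lbrC ui vj) linearN linearZ.
Qed.
Fact quo_jacobi i j k a b c :
  a \in quo_part i -> b \in quo_part j -> c \in quo_part k ->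
  quo_br a (quo_br b c) =
    quo_br (quo_br a b) c + (-1) ^+ (i && j) *: quo_br b (quo_br a c).
Proof.
move=> /quo_partP[u ui ->] /quo_partP[v vj ->] /quo_partP[w wk ->].
by rewrite -!quo_projM (lbr_jacobi ui vj wk) linearD linearZ.
Qed.

Definition quoAlgebra : lieSuperalgebra F :=
  LieSuperalgebra quo_br_linearr quo_br_linearl quo_partD quo_partI
    quo_br_part quo_brC quo_jacobi.

End Quotient.

Section GeneralLinear.
Variables (F : fieldType) (m n : nat).
Implicit Types A B C : 'M[F]_(m + n).

(* The even (i = false) and odd (i = true) components of a supermatrix. *)
Definition gl_comp (i : bool) A : 'M[F]_(m + n) :=
  if i then block_mx 0 (ursubmx A) (dlsubmx A) 0
  else block_mx (ulsubmx A) 0 0 (drsubmx A).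

Arguments gl_comp : simpl never.

Fact gl_comp_is_linear i : linear (gl_comp i).
Proof.
move=> k A B; rewrite /gl_comp -[A]submxK -[B]submxK.
rewrite !(scale_block_mx, add_block_mx, block_mxKul, block_mxKur, block_mxKdl,
          block_mxKdr).
by case: i; rewrite !(scale_block_mx, add_block_mx) !(scaler0, addr0).
Qed.
HB.instance Definition _ i :=
  GRing.isLinear.Build F 'M[F]_(m + n) 'M[F]_(m + n) *:%R (gl_comp i)
    (gl_comp_is_linear i).

Definition gl_part i : {vspace 'M[F]_(m + n)} := lker (linfun (gl_comp (~~ i))).

(* [A, B] = AB - (-1)^{|A||B|} BA for homogeneous A and B (see gl_brE). *)
Definition gl_br A B : 'M[F]_(m + n) :=
  \sum_(i : bool) \sum_(j : bool)
    (gl_comp i A *m gl_comp j B - (-1) ^+ (i && j) *: (gl_comp j B *m gl_comp i A)).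

Lemma gl_compD A : gl_comp false A + gl_comp true A = A.
Proof. by rewrite add_block_mx !(addr0, add0r) submxK. Qed.

Lemma gl_comp_comp i j A :
  gl_comp i (gl_comp j A) = if i == j then gl_comp j A else 0.
Proof.
case: i j => [] []; rewrite /gl_comp /= !(block_mxKul, block_mxKur, block_mxKdl,
  block_mxKdr) //; exact: block_mx_const.
Qed.

Lemma gl_partE i A : (A \in gl_part i) = (gl_comp (~~ i) A == 0).
Proof. by rewrite memv_ker lfunE. Qed.

Lemma gl_comp_id i A : A \in gl_part i -> gl_comp i A = A.
Proof.
rewrite gl_partE => /eqP A0; rewrite -[RHS]gl_compD.
by case: i A0 => /= ->; rewrite ?add0r ?addr0.
Qed.

Lemma gl_comp_part i A : gl_comp i A \in gl_part i.
Proof. by rewrite gl_partE gl_comp_comp; case: i. Qed.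

Lemma gl_brE i j A B : A \in gl_part i -> B \in gl_part j ->
  gl_br A B = A *m B - (-1) ^+ (i && j) *: (B *m A).
Proof.
move=> Ai Bj; rewrite /gl_br !big_bool /=.
have Ei := gl_comp_id Ai; have Ej := gl_comp_id Bj.
move: Ai Bj; rewrite !gl_partE => /eqP A0 /eqP B0.
by case: i j Ei A0 Ej B0 => [] [] /= -> -> -> ->;
  rewrite !(mul0mx, mulmx0, scaler0, oppr0, addr0, add0r).
Qed.

Lemma gl_mul_part i j A B : A \in gl_part i -> B \in gl_part j ->
  A *m B \in gl_part (i (+) j).
Proof.
move=> /gl_comp_id <- /gl_comp_id <-; rewrite gl_partE.
by case: i j => [] []; rewrite /gl_comp /= mulmx_block
  !(block_mxKul, block_mxKur, block_mxKdl, block_mxKdr, mul0mx, mulmx0, addr0)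
  block_mx_const.
Qed.

Fact gl_br_linearr A : linear (gl_br A).
Proof.
move=> k B C; rewrite /gl_br !big_bool /=; rewrite !linearP /=.
rewrite !mulmxDl -!scalemxAl.
set a := (_ *m _); set b := (_ *m _); set c := (_ *m _).
set d := (_ *m _); set a1 := (_ *m _); set a2 := (_ *m _); set a3 := (_ *m _).
by apply/matrixP=> i j; rewrite !mxE; ring.
Qed.
Fact gl_br_linearl B : linear (gl_br^~ B).
Proof.
move=> k A C; rewrite /gl_br !big_bool /=; rewrite !linearP /=.
rewrite !mulmxDl -!scalemxAl.
by apply/matrixP=> i j; do ![set x := (_ *m _); move: x => ?]; rewrite !mxE; ring.
Qed.
Fact gl_partD : (gl_part false + gl_part true = fullv)%VS.
Proof.
apply/vspaceP=> A; rewrite memvf -[A]gl_compD.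
by apply: memv_add; apply: gl_comp_part.
Qed.
Fact gl_partI : (gl_part false :&: gl_part true = 0)%VS.
Proof.
apply/eqP; rewrite -subv0; apply/subvP=> A /memv_capP[].
by rewrite !gl_partE /= -{3}[A]gl_compD => /eqP -> /eqP ->; rewrite addr0 mem0v.
Qed.
Fact gl_br_part i j A B :
  A \in gl_part i -> B \in gl_part j -> gl_br A B \in gl_part (i (+) j).
Proof.
move=> Ai Bj; rewrite (gl_brE Ai Bj); apply: memvB; first exact: gl_mul_part.
by apply: memvZ; rewrite addbC; apply: gl_mul_part.
Qed.
Fact gl_brC i j A B : A \in gl_part i -> B \in gl_part j ->
  gl_br A B = - ((-1) ^+ (i && j) *: gl_br B A).
Proof.
move=> Ai Bj; rewrite (gl_brE Ai Bj) (gl_brE Bj Ai) [j && i]andbC.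
by rewrite scalerBr scalerA -signr_addb addbb scale1r opprB.
Qed.
Fact gl_jacobi i j k A B C :
  A \in gl_part i -> B \in gl_part j -> C \in gl_part k ->
  gl_br A (gl_br B C) =
    gl_br (gl_br A B) C + (-1) ^+ (i && j) *: gl_br B (gl_br A C).
Proof.
move=> Ai Bj Ck.
rewrite (gl_brE Ai (gl_br_part Bj Ck)) (gl_brE (gl_br_part Ai Bj) Ck).
rewrite (gl_brE Bj (gl_br_part Ai Ck)) (gl_brE Bj Ck) (gl_brE Ai Bj).
rewrite (gl_brE Ai Ck) !(mulmxBl, mulmxBr) -!(scalemxAl, scalemxAr) !mulmxA.
move: (A *m B *m C) (A *m C *m B) (B *m C *m A) (C *m B *m A) (B *m A *m C)
      (C *m A *m B) => *.
by apply/matrixP=> x y; rewrite !mxE; case: i j k {Ai Bj Ck} => [] [] [] /=; ring.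
Qed.

Definition gl : lieSuperalgebra F :=
  LieSuperalgebra gl_br_linearr gl_br_linearl gl_partD gl_partI
    gl_br_part gl_brC gl_jacobi.

Definition supertrace A : F^o := \tr (ulsubmx A) - \tr (drsubmx A).

Fact supertrace_is_linear : linear supertrace.
Proof.
move=> k A B; rewrite /supertrace -[A]submxK -[B]submxK.
rewrite scale_block_mx add_block_mx !(block_mxKul, block_mxKdr).
by rewrite !mxtraceD !mxtraceZ /GRing.scale /=; ring.
Qed.
HB.instance Definition _ :=
  GRing.isLinear.Build F 'M[F]_(m + n) F^o *:%R supertrace supertrace_is_linear.

Definition sl_space : {vspace gl} := lker (linfun supertrace).

Lemma sl_spaceE A : (A \in sl_space) = (supertrace A == 0).
Proof. by rewrite memv_ker lfunE. Qed.

Lemma supertrace_odd A : A \in gl_part true -> supertrace A = 0.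
Proof.
by move/gl_comp_id<-; rewrite /supertrace block_mxKul block_mxKdr !linear0 subr0.
Qed.

Fact sl_graded : graded sl_space.
Proof.
apply/eqP; rewrite eqEsubv subv_add !capvSl /=; apply/subvP=> A.
rewrite sl_spaceE -{2}[A : gl]gl_compD => /eqP trA.
have tr1 := supertrace_odd (gl_comp_part true A).
have tr0 : supertrace (gl_comp false A) = 0.
  by rewrite -trA -{2}[A]gl_compD linearD /= tr1 addr0.
by apply: memv_add; rewrite memv_cap sl_spaceE ?tr0 ?tr1 eqxx gl_comp_part.
Qed.

Lemma supertrace_mulC i j A B :
  supertrace (gl_comp i A *m gl_comp j B) =
  (-1) ^+ (i && j) *: supertrace (gl_comp j B *m gl_comp i A).
Proof.
rewrite /supertrace; case: i j => [] []; rewrite /gl_comp /= !mulmx_block;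
  rewrite !(mul0mx, mulmx0, addr0, add0r) !(block_mxKul, block_mxKdr);
  rewrite ?raddf0 ?subrr ?scaler0 ?scale1r ?scaleN1r ?opprB //.
  by rewrite [X in X - _]mxtrace_mulC [X in _ - X]mxtrace_mulC.
by rewrite [X in X - _]mxtrace_mulC [X in _ - X]mxtrace_mulC.
Qed.

Fact sl_closed : lclosed sl_space sl_space sl_space.
Proof.
move=> A B _ _; rewrite sl_spaceE /lbr /= /gl_br linear_sum big1 // => i _.
rewrite linear_sum big1 // => j _.
by rewrite linearB linearZ /= supertrace_mulC subrr.
Qed.

Definition sl : lieSuperalgebra F := subAlgebra sl_graded sl_closed.

End GeneralLinear.

Section ProjectiveSpecialLinear.
Variables (F : fieldType) (m : nat).

Lemma scalar_sl : (1%:M : 'M[F]_(m + m)) \in sl_space F m m.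
Proof.
by rewrite sl_spaceE /supertrace scalar_mx_block block_mxKul block_mxKdr subrr.
Qed.

Definition sl_one : sl F m m := vsproj (sl_space F m m) 1%:M.

Definition sl_scalars : {vspace sl F m m} := <[sl_one]>%VS.

Lemma sl_one_even : sl_one \in lpart false.
Proof.
rewrite sub_partE vsprojK ?scalar_sl // /lpart /= gl_partE.
apply/eqP; rewrite scalar_mx_block /gl_comp /=.
by rewrite block_mxKur block_mxKdl block_mx_const.
Qed.

Lemma sl_one_central (a : sl F m m) : lbr sl_one a = 0 /\ lbr a sl_one = 0.
Proof.
suff H i (b : sl F m m) : b \in lpart i -> lbr sl_one b = 0 /\ lbr b sl_one = 0.
  have: a \in (lpart false + lpart true)%VS by rewrite lpartD memvf.
  case/memv_addP=> u u0 [v v1 ->].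
  have [u2 u3] := H _ _ u0; have [v2 v3] := H _ _ v1.
  by rewrite lbrDr lbrDl u2 u3 v2 v3 addr0.
move=> bi; suff b0 : lbr sl_one b = 0.
  by split=> //; rewrite (lbrC bi sl_one_even) b0 scaler0 oppr0.
apply: val_inj; rewrite /= (sub_brE (@sl_closed F m m)).
move: sl_one_even bi; rewrite !sub_partE /lbr /= => oi bi.
by rewrite (gl_brE oi bi) vsprojK ?scalar_sl //= mul1mx mulmx1 scale1r subrr.
Qed.

Fact sl_scalars_graded : graded sl_scalars.
Proof.
rewrite /graded; have /capv_idPl -> : (sl_scalars <= lpart false)%VS.
  by rewrite -memvE sl_one_even.
by apply/addv_idPl; apply: capvSl.
Qed.
Fact sl_scalars_ideall : lclosed fullv sl_scalars sl_scalars.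
Proof.
move=> a b _ /vlineP[k ->]; rewrite lbrZr.
by rewrite (sl_one_central a).2 scaler0 mem0v.
Qed.
Fact sl_scalars_idealr : lclosed sl_scalars fullv sl_scalars.
Proof.
move=> b a /vlineP[k ->] _; rewrite lbrZl.
by rewrite (sl_one_central a).1 scaler0 mem0v.
Qed.

Definition psl : lieSuperalgebra F :=
  quoAlgebra sl_scalars_graded sl_scalars_ideall sl_scalars_idealr.

Definition psl_proj : 'Hom(sl F m m, psl) := quo_proj sl_scalars.

End ProjectiveSpecialLinear.

(* [typeA m n g pi]: g is sl_{m|n} with m != n, or psl_{m|m} with m = n, and pi
   is the canonical surjection of sl_{m|n} onto g. *)
Inductive typeA (F : fieldType) :
    forall (m n : nat) (g : lieSuperalgebra F), 'Hom(sl F m n, g) -> Prop :=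
  | TypeA_sl m n of m <> n : @typeA F m n (sl F m n) \1%VF
  | TypeA_psl m : @typeA F m m (psl F m) (psl_proj F m).

Section LieNotions.
Variables (F : fieldType) (L : lieSuperalgebra F).
Implicit Types (e x f z : L) (h I J : {vspace L}).

(* The normalization x = [e, f], [x, e] = e, [x, f] = - f, so that x is half of
   the Chevalley generator; freeness makes the span a copy of sl_2. *)
Definition sl2_triple e x f : Prop :=
  [/\ lbr x e = e, lbr x f = - f, lbr e f = x & free [:: e; x; f]].

Definition lspan3 e x f : {vspace L} := <<[:: e; x; f]>>%VS.

Definition ad_nilpotent z : Prop :=
  exists k : nat, forall v, iter k (lbr z) v = 0.

Definition centralizer h : {vspace L} :=
  (\bigcap_(i < \dim h) lker (linfun (lbr_flip (vbasis h)`_i)))%VS.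

Lemma centralizerP h z :
  reflect (forall y, y \in h -> lbr z y = 0) (z \in centralizer h).
Proof.
apply: (iffP idP) => [zC y yh | zC].
  have zi (i : 'I_(\dim h)) : lbr z (vbasis h)`_i = 0.
    move: zC; rewrite memvE => /subv_bigcapP/(_ i isT).
    by rewrite -memvE memv_ker lfunE => /eqP.
  rewrite (coord_vbasis yh) linear_sum big1 // => i _.
  by rewrite linearZ /= zi scaler0.
rewrite memvE; apply/subv_bigcapP=> i _.
by rewrite -memvE memv_ker lfunE /= /lbr_flip zC // vbasis_mem ?mem_nth ?size_tuple.
Qed.

Definition lie_ideal h I : Prop := (I <= h)%VS /\ lclosed h I I.

(* A subalgebra h is a Lie algebra when it has no odd part; it is reductive when
   its adjoint representation is semisimple. *)
Definition reductive_lie_algebra h : Prop :=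
  (h <= lpart false)%VS /\
  forall I, lie_ideal h I ->
    exists J, [/\ lie_ideal h J, (I + J = h)%VS & (I :&: J = 0)%VS].

End LieNotions.

(* A module over a Lie algebra with underlying set A is given by its vector space
   and the action A -> V -> V.  Gradings of the modules are ignored, the algebras
   acting below being purely even. *)
Section Modules.
Variables (F : fieldType) (A : Type).

Section Submodules.
Variables (V : vectType F) (rho : A -> V -> V).

Definition submodule (U : {vspace V}) : Prop :=
  forall a v, v \in U -> rho a v \in U.

Definition irreducible (U : {vspace V}) : Prop :=
  [/\ submodule U, U <> 0%VS &
      forall W, submodule W -> (W <= U)%VS -> W = 0%VS \/ W = U].

(* V is a direct sum of irreducible submodules of dimensions ds_0, ds_1, ...  For
   modules over sl_2 this reads V = V(ds_0 - 1) + V(ds_1 - 1) + ... *)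
Definition decomposes (ds : seq nat) : Prop :=
  exists U : 'I_(size ds) -> {vspace V},
    [/\ (\sum_i U i = fullv)%VS, directv (\sum_i U i)%VS &
        forall i, irreducible (U i) /\ \dim (U i) = nth 0%N ds i].

End Submodules.

Definition module_hom (V W : vectType F) (rhoV : A -> V -> V)
    (rhoW : A -> W -> W) (phi : 'Hom(V, W)) : Prop :=
  forall a v, phi (rhoV a v) = rhoW a (phi v).

Definition power_action (V : vectType F) (rho : A -> V -> V) (k : nat)
    (a : A) (v : {ffun 'I_k -> V}) : {ffun 'I_k -> V} := [ffun i => rho a (v i)].

(* S^k embeds in V. *)
Definition power_embeds (S V : vectType F) (rhoS : A -> S -> S)
    (rhoV : A -> V -> V) (k : nat) : Prop :=
  exists phi : 'Hom({ffun 'I_k -> S}, V),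
    module_hom (@power_action S rhoS k) rhoV phi /\ lker phi = 0%VS.

(* The multiplicity of a nonzero irreducible S in V: the largest k such that S^k
   embeds in V (necessarily k <= dim V).  For semisimple V this is the number of
   summands isomorphic to S in a decomposition into irreducibles. *)
Definition multiplicity (S V : vectType F) (rhoS : A -> S -> S)
    (rhoV : A -> V -> V) : nat :=
  \max_(k < (\dim {:V}).+1 | `[< power_embeds rhoS rhoV k >]) k.

End Modules.

Section Proposition.
Variables (F : fieldType).

Section Adj.
Variables (g : lieSuperalgebra F) (e x f : g).

Definition gnat : {vspace g} := centralizer (lspan3 e x f).

(* The external direct sum of gnat and s, acting on g by the bracket, and on the
   carrier of s through trivial (x) adjoint. *)
Definition gnat_s : Type := (subvs_of gnat * subvs_of (lspan3 e x f))%type.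

Definition g_action (a : gnat_s) (v : g) : g :=
  lbr (vsval a.1 + vsval a.2) v.

Definition triv_adj_action (a : gnat_s) (w : subvs_of (lspan3 e x f)) :
    subvs_of (lspan3 e x f) :=
  vsproj _ (lbr (vsval a.2) (vsval w)).

Definition mult_triv_adj : nat := multiplicity triv_adj_action g_action.

End Adj.

Section Encoding.
Variables (m n : nat).

Definition even_action (s : {vspace sl F m n}) (y : subvs_of s) (v : 'cV[F]_m) :
  'cV[F]_m := ulsubmx (vsval (vsval y)) *m v.
Definition odd_action (s : {vspace sl F m n}) (y : subvs_of s) (v : 'cV[F]_n) :
  'cV[F]_n := drsubmx (vsval (vsval y)) *m v.

(* (alpha | beta) encodes the triple: for a lift (E, X, H) of it to sl_{m|n}, the
   parts of alpha (resp. beta) are the dimensions of the irreducible summands of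
   the even (resp. odd) part of C^{m|n}. *)
Definition encoded (g : lieSuperalgebra F) (pi : 'Hom(sl F m n, g)) (e x f : g)
    (alpha beta : seq nat) : Prop :=
  exists E X H : sl F m n,
    [/\ [/\ E \in lpart false, X \in lpart false & H \in lpart false],
        sl2_triple E X H,
        [/\ pi E = e, pi X = x & pi H = f],
        decomposes (@even_action (lspan3 E X H)) alpha &
        decomposes (@odd_action (lspan3 E X H)) beta].

End Encoding.

End Proposition.

(* The partition (p_0^{k_0}, ..., p_{t-1}^{k_{t-1}}). *)
Definition partition_of (t : nat) (p k : 'I_t -> nat) : seq nat :=
  flatten [seq nseq (k i) (p i) | i : 'I_t].

(* Main.v *)
From HB Require Import structures.
Require Import Defs.
From mathcomp Require Import all_boot all_order all_algebra.
From mathcomp Require Import fingroup perm.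
From mathcomp Require Import boolp reals.
From mathcomp Require Import complex.
From mathcomp Require Import ring zify.

Set Implicit Arguments.
Unset Strict Implicit.
Unset Printing Implicit Defensive.

Import GRing.Theory Num.Theory.
Local Open Scope ring_scope.

(** Write s for the span of the triple, and decompose C^(m|n), as a module over a
    lift of s to sl_(m|n), into irreducible summands U_i of dimension d_i, each
    inside the even or the odd part.  A copy
    of (trivial) x adj in g is determined by its highest weight vector, so the
    multiplicity is the dimension of the space of all w in g with [x, w] = w,
    [e, w] = 0 and [z, w] = 0 for every z in the centralizer of s.

    Everything is computed with matrices.  The kernel of the projection from
    sl_(m|n) to g consists of scalar matrices, and relations that hold up to
    central elements become exact after bracketing with x ([gnat_lift],
    [highest_vector_span]).  An isomorphism between an even and an odd U_i is an
    odd element of the centralizer; as the centralizer is purely even, summands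
    of equal dimension have equal parity ([equal_length_parity]).

    Upper bound ([weight_two_span]): let A be a matrix that lifts some w as above.
    For i != j, a combination of the projectors onto U_i and U_j has supertrace
    zero and acts on the block A_ij by the scalar eps_j d_j + eps_i d_i, where
    eps is the sign of the parity.  That scalar is nonzero since equal dimensions
    have equal parities, so A is block diagonal.  By sl_2-theory A acts on U_i as
    c_i e, and commuting with the isomorphisms U_i -> U_j gives c_i = c_j whenever
    d_i = d_j.  Hence A is a combination of the P_q e, where P_q is the projector
    onto the isotypic component of dimension q > 1.

    Lower bound ([isotypic_embedding]): the maps y |-> P_q y embed s into g.  They
    are s-equivariant, and equivariant for the centralizer because P_q is central
    in the commutant of s: the Casimir operator separates the dimensions.  The
    images have supertrace zero because P_q [a, b] = [P_q a, b], and they are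
    independent by their action on the first two vectors of a single U_i.

    So the multiplicity is the number of distinct parts greater than 1
    ([encoded_multiplicity]).  When there is a single one, the fact that no part
    occurs on both sides leaves only the four listed shapes
    ([encoding_shapes]). *)

(** * Irreducible sl_2-modules inside column space *)

Section Eigenvectors.
Variable F : numClosedFieldType.

(** Apply the linear factors of the characteristic polynomial to a vector of K
    one after the other: by Cayley-Hamilton some factor is the first to give
    zero, and the vector it is applied to is an eigenvector. *)
Lemma stable_eigenvector m (x : 'M[F]_m) (K : {vspace 'cV[F]_m}) :
    K <> 0%VS -> (forall v, v \in K -> x *m v \in K) ->
  exists r v, [/\ v \in K, v != 0 & x *m v = r *: v].
Proof.
move=> K0 xK; have := memv_pick K; have: vpick K != 0.
  by rewrite vpick0; apply/eqP.
case: m x K K0 xK => [|m] x K K0 xK.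
  by rewrite [vpick K]flatmx0 eqxx.
have [rs Ers] := closed_field_poly_normal (char_poly x).
have: horner_mx x (char_poly x) *m vpick K = 0.
  by rewrite Cayley_Hamilton mul0mx.
rewrite Ers (eqP (char_poly_monic x)) scale1r {Ers}.
elim: rs (vpick K) => [|r rs IHrs] v p0 v0 vK.
  by move: p0; rewrite big_nil rmorph1 mul1mx => /eqP; rewrite (negPf v0).
have [xv|xv] := eqVneq (x *m v - r *: v) 0.
  by exists r, v; split=> //; apply/subr0_eq.
apply: (IHrs (x *m v - r *: v)) => //; last by rewrite memvB ?xK ?memvZ.
rewrite -[RHS]p0 big_cons mulrC rmorphM /= -mulmxA; congr (_ *m _).
by rewrite rmorphB /= horner_mx_X horner_mx_C mulmxBl mul_scalar_mx.
Qed.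

Lemma char_poly_tr m (x : 'M[F]_m) : char_poly x^T = char_poly x.
Proof.
by rewrite /char_poly -det_tr /char_poly_mx linearB /= tr_scalar_mx map_trmx trmxK.
Qed.

Lemma eigenvector_root m (x : 'M[F]_m) r (v : 'cV[F]_m) :
  v != 0 -> x *m v = r *: v -> root (char_poly x) r.
Proof.
move=> v0 xv; rewrite -char_poly_tr -eigenvalue_root_char.
apply/eigenvalueP; exists v^T; first by rewrite -trmx_mul xv linearZ.
by rewrite -(inj_eq trmx_inj) trmxK trmx0.
Qed.

Lemma iter_eigenvector m (x a : 'M[F]_m) c r (v : 'cV[F]_m) k :
    x *m a - a *m x = c *: a -> x *m v = r *: v ->
  x *m iter k (mulmx a) v = (r + k%:R * c) *: iter k (mulmx a) v.
Proof.
move=> /eqP; rewrite subr_eq => /eqP xa xv.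
elim: k => [|k IHk] /=; first by rewrite mul0r addr0.
rewrite mulmxA xa mulmxDl -mulmxA IHk -scalemxAl -scalemxAr -scalerDl.
by congr (_ *: _); rewrite -natr1; ring.
Qed.

(** The nonzero iterates are eigenvectors of x for distinct eigenvalues, and x
    has only finitely many of those. *)
Lemma iter_eigenvector_eq0 m (x a : 'M[F]_m) c r (v : 'cV[F]_m) :
    c != 0 -> x *m a - a *m x = c *: a -> x *m v = r *: v ->
  exists k, iter k (mulmx a) v == 0.
Proof.
move=> c0 xa xv; apply: contrapT => /forallNP nz.
pose rs := [seq r + k%:R * c | k <- iota 0 m.+1].
have rs_root : all (root (char_poly x)) rs.
  apply/allP=> _ /mapP[k _ ->]; apply: (eigenvector_root _ (iter_eigenvector k xa xv)).
  by apply/negP/nz.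
have rs_uniq : uniq rs.
  rewrite map_inj_in_uniq ?iota_uniq // => k l _ _ /addrI /(mulIf c0) /eqP.
  by rewrite eqr_nat => /eqP.
have := max_poly_roots (monic_neq0 (char_poly_monic x)) rs_root rs_uniq.
by rewrite size_char_poly size_map size_iota ltnn.
Qed.

(** With a = h this provides a lowest weight vector, with a = e the length of the
    chain that starts there. *)
Lemma last_iterate m (x a : 'M[F]_m) c r (v : 'cV[F]_m) :
    c != 0 -> x *m a - a *m x = c *: a -> v != 0 -> x *m v = r *: v ->
  exists d, [/\ (0 < d)%N, iter d (mulmx a) v = 0 &
                forall k, (k < d)%N -> iter k (mulmx a) v != 0].
Proof.
move=> c0 xa v0 xv; have ex0 := iter_eigenvector_eq0 c0 xa xv.
case: (ex_minnP ex0) => d /eqP d0 dmin; exists d; split=> //.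
  by case: d d0 {dmin} => [/= v00|//]; rewrite v00 eqxx in v0.
by move=> k ltkd; apply/negP=> /dmin; rewrite leqNgt ltkd.
Qed.

End Eigenvectors.

Section Chains.
Variable F : numClosedFieldType.

(** With x normalized to half of the usual Cartan generator, these are the weight
    of the k-th vector from the bottom of the irreducible module of dimension d,
    and the coefficient with which h lowers that vector when e raises each vector
    exactly to the next one. *)
Definition sl2_weight (d k : nat) : F := k%:R - (d%:R - 1) / 2.
Definition sl2_lower (d k : nat) : F := k%:R * (d%:R - k%:R) / 2.

(** Chains start from a lowest weight vector and are climbed by e without
    rescaling, so that an operator commuting with e is known on the whole chain
    once it is known on its first vector. *)
Definition sl2_chain m (e x h : 'M[F]_m) (d : nat) (u : nat -> 'cV[F]_m) :=
  [/\ forall k, (d <= k)%N -> u k = 0,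
      forall k, e *m u k = u k.+1,
      forall k, x *m u k = sl2_weight d k *: u k &
      forall k, h *m u k = sl2_lower d k *: u k.-1].

Definition sl2_relations m (e x h : 'M[F]_m) :=
  [/\ x *m e - e *m x = e, x *m h - h *m x = - h & e *m h - h *m e = x].

Definition stable3 m (e x h : 'M[F]_m) (U : {vspace 'cV[F]_m}) :=
  forall v, v \in U -> [/\ e *m v \in U, x *m v \in U & h *m v \in U].

Lemma nat_half_neq0 k : (0 < k)%N -> (k%:R / 2 : F) != 0.
Proof. by move=> k0; rewrite mulf_neq0 ?invr_eq0 ?pnatr_eq0 -?lt0n. Qed.

Lemma sl2_lower_neq0 d k : (0 < k < d)%N -> sl2_lower d k != 0.
Proof.
case/andP=> k0 kd; rewrite /sl2_lower -natrB 1?ltnW // -mulrA mulf_neq0 //.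
  by rewrite pnatr_eq0 -lt0n.
by rewrite nat_half_neq0 // subn_gt0.
Qed.

Lemma sl2_weightS d k : sl2_weight d k.+1 = sl2_weight d k + 1.
Proof. by rewrite /sl2_weight -natr1; ring. Qed.

(** Moving h past e by [e, h] = x gives the coefficient of h on every iterate of v
    under e.  The iterates stop, and the coefficient at the stop must be zero:
    this forces r = (1 - d) / 2. *)
Lemma lowest_vector_chain m (e x h : 'M[F]_m) (v : 'cV[F]_m) r :
    sl2_relations e x h -> v != 0 -> x *m v = r *: v -> h *m v = 0 ->
  exists d, [/\ (0 < d)%N, sl2_chain e x h d (fun k => iter k (mulmx e) v) &
                forall k, (k < d)%N -> iter k (mulmx e) v != 0].
Proof.
move=> [xe xh eh] v0 xv hv.
have xe1 : x *m e - e *m x = 1 *: e by rewrite scale1r.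
have [d [d0 ud unz]] := last_iterate (oner_neq0 F) xe1 v0 xv.
pose u k := iter k (mulmx e) v.
have xu k : x *m u k = (r + k%:R) *: u k.
  by rewrite (iter_eigenvector k xe1 xv) mulr1.
have hu k : h *m u k.+1 = (- (k%:R + 1) * (r + k%:R / 2)) *: u k.
  have he : h *m e = e *m h - x by rewrite -eh subKr.
  elim: k => [|k IHk]; rewrite /= mulmxA he mulmxBl -mulmxA.
    rewrite /= hv mulmx0 sub0r [x *m _](xu 0%N) -scaleNr.
    by congr (_ *: _); field.
  rewrite [h *m _]IHk -scalemxAr [x *m _](xu k.+1) -scalerBl.
  by congr (_ *: _); rewrite -!natr1; field.
(* The chain stops after u_(d-1), so the coefficient of h u_d is zero. *)
have rE : r = sl2_weight d 0.
  have := hu d.-1; rewrite prednK // [u d]ud mulmx0 => /esym/eqP.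
  rewrite scaler_eq0 orbC (negPf (unz d.-1 _)) ?prednK //= mulf_eq0 oppr_eq0.
  rewrite natr1 prednK // pnatr_eq0 -[d == _]negbK -lt0n d0 /=.
  rewrite addr_eq0 => /eqP ->.
  by rewrite /sl2_weight -{2}(prednK d0) -natr1; field.
exists d; split=> //; split=> [k dk|//|k|k].
- by rewrite -(subnK dk) iterD ud; elim: (k - d)%N => //= j ->; rewrite mulmx0.
- by rewrite [x *m _]xu rE /sl2_weight; congr (_ *: _); ring.
case: k => [|k]; first by rewrite /= hv /sl2_lower !mul0r scale0r.
rewrite [h *m _]hu rE /= /sl2_weight /sl2_lower; congr (_ *: _).
by rewrite -!natr1; field.
Qed.

(** A relation between the vectors of a chain, multiplied by a suitable power
    of e, isolates the top vector with the lowest nonzero coefficient. *)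
Lemma chain_free m (e x h : 'M[F]_m) d (u : nat -> 'cV[F]_m) :
    sl2_chain e x h d u -> (forall k, (k < d)%N -> u k != 0) ->
  forall c : nat -> F, \sum_(k < d) c k *: u k = 0 ->
  forall k, (k < d)%N -> c k = 0.
Proof.
move=> [u0 eu _ _] unz c cu; elim/ltn_ind=> k IHk kd.
have iu j l : iter j (mulmx e) (u l) = u (j + l)%N.
  by elim: j => //= j ->; rewrite eu.
have iD j I (r : seq I) (G : I -> 'cV[F]_m) :
    iter j (mulmx e) (\sum_(i <- r) G i) = \sum_(i <- r) iter j (mulmx e) (G i).
  by elim: j => //= j ->; rewrite mulmx_sumr.
have iZ j a v : iter j (mulmx e) (a *: v) = a *: iter j (mulmx e) v.
  by elim: j => //= j ->; rewrite scalemxAr.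
have := congr1 (iter (d.-1 - k) (mulmx e)) cu.
have -> : iter (d.-1 - k) (mulmx e) 0 = 0 :> 'cV[F]_m.
  by elim: (d.-1 - k)%N => //= j ->; rewrite mulmx0.
rewrite iD (bigD1 (Ordinal kd)) //= big1 => [|i /eqP ik]; last first.
  rewrite iZ iu; have [ltik|lekI] := ltnP i k; first by rewrite IHk ?scale0r.
  have ltki : (k < i)%N.
    by rewrite ltn_neqAle lekI andbT; apply/eqP=> E; apply/ik/val_inj.
  by rewrite u0 ?scaler0 //; lia.
have kd1 : (k <= d.-1)%N by lia.
rewrite iZ iu subnK // addr0 => /eqP; rewrite scaler_eq0 => /orP[/eqP//|].
by rewrite (negPf (unz _ _)) // prednK // (leq_ltn_trans _ kd).
Qed.

(** The chain generated by a lowest weight vector of U spans a nonzero submodule,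
    which is U by irreducibility. *)
Lemma irreducible_chain m (e x h : 'M[F]_m) (U : {vspace 'cV[F]_m}) :
    sl2_relations e x h -> U <> 0%VS -> stable3 e x h U ->
    (forall W, stable3 e x h W -> (W <= U)%VS -> W = 0%VS \/ W = U) ->
  exists u, sl2_chain e x h (\dim U) u /\
    basis_of U [tuple u k | k < \dim U].
Proof.
move=> rel U0 stU irrU; have [xe xh eh] := rel.
have [r [w [wU w0 xw]]] : exists r v, [/\ v \in U, v != 0 & x *m v = r *: v].
  by apply: stable_eigenvector => // v /stU[].
have N10 : -1 != 0 :> F by rewrite oppr_eq0 oner_eq0.
have xh1 : x *m h - h *m x = -1 *: h by rewrite scaleN1r.
have [d' [d'0 hd' unz']] := last_iterate N10 xh1 w0 xw.
pose v := iter d'.-1 (mulmx h) w.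
have vU : v \in U by rewrite /v; elim: d'.-1 => //= k /stU[].
have xv := iter_eigenvector d'.-1 xh1 xw.
have hv : h *m v = 0 by rewrite -hd' -{1}(prednK d'0).
have v0 : v != 0 by apply: unz'; rewrite prednK.
have [d [d0 chain unz]] := lowest_vector_chain rel v0 xv hv.
pose u k := iter k (mulmx e) v; have [u0 eu xu hu] := chain.
have uU k : u k \in U by rewrite /u; elim: k => //= k /stU[].
pose X := [tuple u i | i < d]; pose W := <<X>>%VS.
have Xi (i : 'I_d) : X`_i = u i by rewrite -tnth_nth tnth_mktuple.
have uW k : u k \in W.
  have [kd|dk] := ltnP k d; last by rewrite [u k]u0 ?mem0v.
  by apply/memv_span/tnthP; exists (Ordinal kd); rewrite tnth_mktuple.
have WU : (W <= U)%VS by apply/span_subvP=> _ /tnthP[k ->]; rewrite tnth_mktuple.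
have WP y : y \in W -> exists c : 'I_d -> F, y = \sum_k c k *: u k.
  move/coord_span ->; exists (fun k => coord X k y).
  by apply: eq_bigr => k _; rewrite Xi.
have stW : stable3 e x h W.
  move=> _ /WP[c ->]; split; rewrite mulmx_sumr; apply: memv_suml => k _;
    rewrite -scalemxAr memvZ //.
  - exact: (uW k.+1).
  - by rewrite [x *m _]xu memvZ ?uW.
  - by rewrite [h *m _]hu memvZ ?uW.
have EW : W = U.
  case: (irrU W stW WU) => // W0; have := uW 0%N.
  by rewrite W0 memv0 (negPf v0).
have freeX : free X.
  apply/freeP=> c c0 i; pose c' k := if insub k is Some j then c j else 0.
  have c'E (j : 'I_d) : c' j = c j by rewrite /c' valK.
  rewrite -c'E; apply: (chain_free chain unz) => //; rewrite -[RHS]c0.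
  by apply: eq_bigr => j _; rewrite c'E Xi.
have dU : \dim U = d by rewrite -EW (eqP freeX) size_tuple.
by exists u; rewrite dU; split=> //; apply/andP; split=> //; apply/eqP.
Qed.

End Chains.

(** * Bases adapted to a decomposition *)

Section AdaptedBases.
Variable F : numClosedFieldType.

Lemma mulmx_cV_inj m n (A B : 'M[F]_(m, n)) :
  (forall v : 'cV_n, A *m v = B *m v) -> A = B.
Proof.
move=> AB; apply/matrixP=> i j.
by have /matrixP/(_ i 0) := AB (delta_mx j 0); rewrite -!colE !mxE.
Qed.

Lemma functional_row m (f : 'cV[F]_m -> F) :
    linear (f : 'cV[F]_m -> F^o) ->
  exists phi : 'rV_m, forall v, phi *m v = (f v)%:M.
Proof.
move=> lf; pose ff := GRing.isLinear.Build _ _ _ _ _ lf.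
pose f' : {linear 'cV[F]_m -> F^o} := HB.pack (f : 'cV[F]_m -> F^o) ff.
exists (\row_j f (delta_mx j 0)) => v; rewrite [RHS]mx11_scalar !mxE eqxx mulr1n.
apply/matrixP=> i j; rewrite !ord1 !mxE eqxx mulr1n.
rewrite [in RHS](matrix_sum_delta v) -[RHS]/(f' _) linear_sum.
apply: eq_bigr => k _; rewrite big_ord1 linearZ /= mxE mulrC; congr (_ * _).
Qed.

(** The rows phi are the dual basis, so that u i k *m phi j l are the matrix
    units of the basis u. *)
Record sl2_basis N (e x h : 'M[F]_N) (I : finType) (d : I -> nat)
    (u : I -> nat -> 'cV[F]_N) (phi : I -> nat -> 'rV[F]_N) : Prop := Sl2Basis {
  sl2_basis_pos : forall i, (0 < d i)%N;
  sl2_basis_chain : forall i, sl2_chain e x h (d i) (u i);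
  sl2_basis_dual : forall i j k l, (k < d i)%N -> (l < d j)%N ->
    phi i k *m u j l = ((i == j) && (k == l))%:R%:M;
  sl2_basis_full : \sum_i \sum_(k < d i) u i k *m phi i k = 1%:M
}.

(** The row phi i k reads off the k-th coordinate of the i-th component of a
    vector, which is a linear functional because the sum of the U i is direct. *)
Lemma decomposes_sl2_basis m (e x h : 'M[F]_m) (A : Type)
    (rho : A -> 'cV[F]_m -> 'cV[F]_m) (ds : seq nat) :
    sl2_relations e x h ->
    (exists a, rho a =1 mulmx e) -> (exists a, rho a =1 mulmx x) ->
    (exists a, rho a =1 mulmx h) ->
    (forall a, exists b c d, forall v,
      rho a v = b *: (e *m v) + c *: (x *m v) + d *: (h *m v)) ->
    decomposes rho ds ->
  exists u phi, sl2_basis e x h (fun i : 'I_(size ds) => nth 0%N ds i) u phi.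
Proof.
move=> rel [ae aeE] [ax axE] [ah ahE] rhoE [U [sumU dxU irrU]].
have stP W : submodule rho W <-> stable3 e x h W.
  split=> [sW v vW|sW a v vW].
    by split; [rewrite -aeE | rewrite -axE | rewrite -ahE]; apply: sW.
  have [b [c [d ->]]] := rhoE a; have [? ? ?] := sW v vW.
  by rewrite !memvD ?memvZ.
have /fin_all_exists[u uP] i : exists u, sl2_chain e x h (\dim (U i)) u /\
    basis_of (U i) [tuple u k | k < \dim (U i)].
  have [[sU U0 minU] _] := irrU i.
  apply: irreducible_chain => // [|W sW WU]; first exact/stP.
  by apply: minU => //; apply/stP.
have dU i : \dim (U i) = nth 0%N ds i by have [] := irrU i.
have pos (i : 'I_(size ds)) : (0 < nth 0%N ds i)%N.
  have [[_ U0 _] _] := irrU i; rewrite -dU lt0n dimv_eq0.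
  exact/eqP.
pose comp i v := sumv_pi (\sum_i U i)%VS i v.
have sum_comp v : \sum_i comp i v = v by apply: sumv_pi_sum; rewrite sumU memvf.
have comp_id i j w : w \in U j -> comp i w = if i == j then w else 0.
  move=> wU; pose w' i := if i == j then w else 0.
  have /directv_sum_unique/(_ (comp^~ w) w') := dxU; rewrite sum_comp.
  have -> : \sum_i w' i = w by rewrite /w' -big_mkcond big_pred1_eq.
  rewrite eqxx => /(_ _ _)/esym/forall_inP H; apply/eqP/H => //.
    by move=> k _; apply: memv_sum_pi.
  by move=> k _; rewrite /w'; case: eqP => [->|_]; rewrite ?mem0v.
pose X i := [tuple u i k | k < \dim (U i)].
pose co i (k : nat) v := if insub k is Some k' then coord (X i) k' (comp i v) else 0.
have /fin_all_exists[phi phiP] i : exists phi : nat -> 'rV[F]_m,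
    forall k v, phi k *m v = (co i k v)%:M.
  have ex_row k : exists phi : 'rV[F]_m, forall v, phi *m v = (co i k v)%:M.
    apply: functional_row => b v w; rewrite /co.
    by case: insub => [k'|]; rewrite ?scaler0 ?addr0 // /comp !linearP.
  by have [phi phiP] := choice ex_row; exists phi.
have Xk i (k : 'I_(\dim (U i))) : (X i)`_k = u i k.
  by rewrite -tnth_nth tnth_mktuple.
have uU i k : (k < \dim (U i))%N -> u i k \in U i.
  move=> kd; have [_ bas] := uP i; apply: (basis_mem bas).
  by apply/tnthP; exists (Ordinal kd); rewrite tnth_mktuple.
exists u, phi; split=> //.
- by move=> i; rewrite -dU; case: (uP i).
- move=> i j k l; rewrite -!dU => ki lj; rewrite phiP /co insubT (comp_id i j) ?uU //.
  case: eqP => [ij|_]; last by rewrite linear0.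
  case: _ / ij lj => li; rewrite -[l]/(nat_of_ord (Ordinal li)) -Xk.
  have [_ /andP[_ freeX]] := uP i.
  by rewrite coord_free // eq_sym -val_eqE /= eq_sym.
apply: mulmx_cV_inj => v; rewrite mul1mx mulmx_suml -[RHS]sum_comp.
apply: eq_bigr => i _; have [_ bas] := uP i.
rewrite [RHS](coord_basis bas) ?memv_sum_pi // mulmx_suml -dU.
apply: eq_bigr => k _; rewrite -mulmxA phiP /co valK mul_mx_scalar.
by rewrite -[X in _ = _ *: X]tnth_nth tnth_mktuple.
Qed.

Lemma sl2_basis_sum m n (e x h : 'M[F]_m) (e' x' h' : 'M[F]_n)
    (I J : finType) d d' u u' phi phi' :
    @sl2_basis m e x h I d u phi -> @sl2_basis n e' x' h' J d' u' phi' ->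
  sl2_basis (block_mx e 0 0 e') (block_mx x 0 0 x') (block_mx h 0 0 h')
    (fun i : I + J => match i with inl a => d a | inr b => d' b end)
    (fun i k => match i with inl a => col_mx (u a k) 0 | inr b => col_mx 0 (u' b k) end)
    (fun i k => match i with inl a => row_mx (phi a k) 0 | inr b => row_mx 0 (phi' b k) end).
Proof.
move=> [pos chain dual full] [pos' chain' dual' full']; split.
- by case.
- case=> a; [have [u0 eu xu hu] := chain a | have [u0 eu xu hu] := chain' a];
    split=> k; rewrite ?mul_block_col ?scale_col_mx ?mul0mx ?mulmx0 ?scaler0
      ?addr0 ?add0r ?eu ?xu ?hu //; by move=> /u0->; rewrite col_mx0.
- case=> [a|b] [a'|b'] k l kd ld; rewrite mul_row_col ?mul0mx ?mulmx0 ?addr0 ?add0r;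
    by rewrite ?dual ?dual' //= mulr0n raddf0.
rewrite big_sumType /=.
rewrite (eq_bigr (fun a => block_mx (\sum_(k < d a) u a k *m phi a k) 0 0 0));
  last first.
  move=> a _; elim/big_rec2: _ => [|k A B _ ->]; first by rewrite block_mx_const.
  by rewrite mul_col_row !(mul0mx, mulmx0) add_block_mx !addr0.
rewrite [X in _ + X](eq_bigr (fun b => block_mx 0 0 0 (\sum_(k < d' b) u' b k *m phi' b k)));
  last first.
  move=> b _; elim/big_rec2: _ => [|k A B _ ->]; first by rewrite block_mx_const.
  by rewrite mul_col_row !(mul0mx, mulmx0) add_block_mx !addr0.
have -> : \sum_a block_mx (\sum_(k < d a) u a k *m phi a k) 0 0 0 =
    block_mx (1%:M : 'M_m) 0 0 (0 : 'M_n).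
  rewrite -full; elim/big_rec2: _ => [|a A B _ ->]; first by rewrite block_mx_const.
  by rewrite add_block_mx !addr0.
have -> : \sum_b block_mx 0 0 0 (\sum_(k < d' b) u' b k *m phi' b k) =
    block_mx (0 : 'M_m) 0 0 (1%:M : 'M_n).
  rewrite -full'; elim/big_rec2: _ => [|a A B _ ->]; first by rewrite block_mx_const.
  by rewrite add_block_mx !addr0.
by rewrite add_block_mx !addr0 !add0r -scalar_mx_block.
Qed.

End AdaptedBases.

(** * The commutant of sl_2 and its highest weight vectors of weight two *)

Section Commutant.
Variables (F : numClosedFieldType) (N : nat) (e x h sigma : 'M[F]_N).
Variables (I : finType) (d : I -> nat) (par : I -> bool).
Variables (u : I -> nat -> 'cV[F]_N) (phi : I -> nat -> 'rV[F]_N).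
Hypothesis basis : sl2_basis e x h d u phi.
Hypothesis sigma_u : forall i k, sigma *m u i k = (-1) ^+ par i *: u i k.

Let u0 i k : (d i <= k)%N -> u i k = 0.
Proof. by have [? _ _ _] := sl2_basis_chain basis i; auto. Qed.
Let eu i k : e *m u i k = u i k.+1.
Proof. by have [_ ? _ _] := sl2_basis_chain basis i. Qed.
Let xu i k : x *m u i k = sl2_weight F (d i) k *: u i k.
Proof. by have [_ _ ? _] := sl2_basis_chain basis i. Qed.
Let hu i k : h *m u i k = sl2_lower F (d i) k *: u i k.-1.
Proof. by have [_ _ _ ?] := sl2_basis_chain basis i. Qed.
Let dual := sl2_basis_dual basis.

Lemma eq_on_basis p (A B : 'M[F]_(p, N)) :
  (forall i k, (k < d i)%N -> A *m u i k = B *m u i k) -> A = B.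
Proof.
move=> AB; rewrite -[A]mulmx1 -[B]mulmx1 -(sl2_basis_full basis) !mulmx_sumr.
apply: eq_bigr => i _; rewrite !mulmx_sumr; apply: eq_bigr => k _.
by rewrite !mulmxA AB.
Qed.

Lemma eq_on_dual p (A B : 'M[F]_(N, p)) :
  (forall i k, (k < d i)%N -> phi i k *m A = phi i k *m B) -> A = B.
Proof.
move=> AB; rewrite -[A]mul1mx -[B]mul1mx -(sl2_basis_full basis) !mulmx_suml.
apply: eq_bigr => i _; rewrite !mulmx_suml; apply: eq_bigr => k _.
by rewrite -!mulmxA AB.
Qed.

Lemma basis_neq0 i k : (k < d i)%N -> u i k != 0.
Proof.
move=> ki; apply/eqP=> uik; have /matrixP/(_ 0 0) := dual ki ki.
by rewrite uik mulmx0 !eqxx !mxE eqxx => /esym/eqP; rewrite oner_eq0.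
Qed.

Definition commutes_sl2 (Z : 'M[F]_N) :=
  [/\ Z *m e = e *m Z, Z *m x = x *m Z & Z *m h = h *m Z].

(** For d i = d j this is the isomorphism of chains from j to i extended by zero;
    chain_hom i i is the projector onto the i-th chain. *)
Definition chain_hom i j : 'M[F]_N := \sum_(k < d j) u i k *m phi j k.

Lemma chain_homE i j l k : d i = d j ->
  chain_hom i j *m u l k = if l == j then u i k else 0.
Proof.
move=> dij; have [lk|kl] := leqP (d l) k.
  rewrite (u0 lk) mulmx0; case: eqP => // lj.
  by rewrite u0 // dij -lj.
rewrite /chain_hom mulmx_suml; case: eqP => [lj|lj]; last first.
  apply: big1 => k' _; rewrite -mulmxA dual // [j == l]eq_sym.
  by rewrite (introF eqP lj) raddf0 mulmx0.
rewrite lj in kl *; rewrite (bigD1 (Ordinal kl)) //= big1 => [|k' k'k].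
  by rewrite addr0 -mulmxA dual // !eqxx mulmx1.
by rewrite -mulmxA dual // -val_eqE /= in k'k *; rewrite (negPf k'k) andbF raddf0 mulmx0.
Qed.

Lemma chain_hom_commutes i j : d i = d j -> commutes_sl2 (chain_hom i j).
Proof.
move=> dij; split; apply: eq_on_basis => l k kl; rewrite -!mulmxA.
- by rewrite eu !chain_homE //; case: eqP; rewrite ?mulmx0 ?eu.
- rewrite xu -scalemxAr !chain_homE //; case: eqP => [->|_].
    by rewrite xu dij.
  by rewrite mulmx0 scaler0.
- rewrite hu -scalemxAr !chain_homE //; case: eqP => [->|_].
    by rewrite hu dij.
  by rewrite mulmx0 scaler0.
Qed.

Lemma chain_hom_parity i j : d i = d j ->
  sigma *m chain_hom i j = (-1) ^+ (par i (+) par j) *: (chain_hom i j *m sigma).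
Proof.
move=> dij; apply: eq_on_basis => l k kl.
rewrite -scalemxAl -!mulmxA sigma_u -scalemxAr !chain_homE //; case: eqP => [->|_].
  by rewrite sigma_u scalerA signr_addb -mulrA -signr_addb addbb mulr1.
by rewrite mulmx0 !scaler0.
Qed.

Lemma chain_hom_neq0 i j : d i = d j -> chain_hom i j != 0.
Proof.
move=> dij; have di := sl2_basis_pos basis i; apply/eqP=> T0.
have := chain_homE j 0 dij; rewrite T0 mul0mx eqxx => /esym/eqP.
by rewrite (negPf (basis_neq0 di)).
Qed.

Lemma chain_hom_trace i j : d i = d j ->
  \tr (sigma *m chain_hom i j) = if i == j then (-1) ^+ par i * (d i)%:R else 0.
Proof.
move=> dij; rewrite /chain_hom mulmx_sumr raddf_sum /=.
under eq_bigr => k _.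
  rewrite mulmxA sigma_u -scalemxAl mxtraceZ mxtrace_mulC dual ?dij //.
  by rewrite eqxx andbT mxtrace_scalar mulr1n eq_sym; over.
rewrite -mulr_sumr; case: eqP => _; last by rewrite big1 ?mulr0.
by rewrite sumr_const card_ord dij.
Qed.

(** The Casimir operator acts on a chain of length d by (d^2 - 1) / 4, hence
    tells chains of distinct lengths apart. *)
Definition casimir : 'M[F]_N := x *m x - x + 2 *: (e *m h).

Lemma casimir_basis i k :
  casimir *m u i k = (((d i)%:R ^+ 2 - 1) / 4) *: u i k.
Proof.
have ehu : e *m (h *m u i k) = sl2_lower F (d i) k *: u i k.
  rewrite hu -scalemxAr eu; case: k => [|k] //=.
  by rewrite /sl2_lower !mul0r !scale0r.
rewrite /casimir mulmxDl mulmxBl -scalemxAl -!mulmxA ehu xu -scalemxAr xu !scalerA.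
rewrite -scalerBl -scalerDl; congr (_ *: _).
by rewrite /sl2_weight /sl2_lower; field.
Qed.

Lemma casimir_dual i k : (k < d i)%N ->
  phi i k *m casimir = (((d i)%:R ^+ 2 - 1) / 4) *: phi i k.
Proof.
move=> ki; apply: eq_on_basis => j l lj.
rewrite -mulmxA casimir_basis -scalemxAl -scalemxAr dual //.
by case: eqP => [->//|_]; rewrite raddf0 !scaler0.
Qed.

(** Z commutes with the Casimir operator, which has different eigenvalues on the
    two chains. *)
Lemma commutant_block Z i j k l : commutes_sl2 Z -> d i <> d j ->
  (k < d i)%N -> (l < d j)%N -> phi i k *m (Z *m u j l) = 0.
Proof.
move=> [Ze Zx Zh] dij ki lj.
have ZC : Z *m casimir = casimir *m Z.
  rewrite /casimir mulmxDr mulmxDl mulmxBr mulmxBl -scalemxAr -scalemxAl.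
  by rewrite !mulmxA Zx Ze -(mulmxA x Z) Zx -(mulmxA e Z) Zh !mulmxA.
have : phi i k *m (casimir *m (Z *m u j l)) = phi i k *m (Z *m (casimir *m u j l)).
  by congr (_ *m _); rewrite !mulmxA ZC.
rewrite mulmxA casimir_dual // casimir_basis -!scalemxAr -scalemxAl.
move/eqP; rewrite -subr_eq0 -scalerBl scaler_eq0 => /orP[|/eqP//].
have -> : ((d i)%:R ^+ 2 - 1) / 4 - ((d j)%:R ^+ 2 - 1) / 4 =
    ((d i)%:R - (d j)%:R) * (((d i)%:R + (d j)%:R) / 4) :> F by field.
rewrite mulf_eq0 subr_eq0 eqr_nat; case: eqP => //= _.
by rewrite mulf_eq0 invr_eq0 -natrD !pnatr_eq0 addn_eq0 -leqn0 leqNgt (leq_trans _ ki).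
Qed.

Definition isotypic_proj q : 'M[F]_N := \sum_(i | d i == q) chain_hom i i.

Lemma isotypic_projE q i k :
  isotypic_proj q *m u i k = if d i == q then u i k else 0.
Proof.
rewrite /isotypic_proj mulmx_suml.
under eq_bigr => j _ do rewrite chain_homE //.
case: ifP => iq; last by apply: big1 => j /eqP jq; case: eqP => // ij; rewrite ij jq eqxx in iq.
rewrite (bigD1 i) //= eqxx big1 ?addr0 // => j /andP[_ ji].
by rewrite eq_sym (negPf ji).
Qed.

Lemma isotypic_proj_central q Z :
  commutes_sl2 Z -> isotypic_proj q *m Z = Z *m isotypic_proj q.
Proof.
move=> cZ; apply: eq_on_basis => j l lj; apply: eq_on_dual => i k ki.
have phiP : phi i k *m isotypic_proj q = (d i == q)%:R *: phi i k.
  apply: eq_on_basis => i' k' ki'; rewrite -mulmxA isotypic_projE -scalemxAl dual //.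
  have [ii'|ne] := eqVneq i i'; last first.
    by case: ifP; rewrite ?mulmx0 ?raddf0 ?scaler0 // dual // (negPf ne) raddf0.
  rewrite -ii' in ki' *; case: ifP => _; rewrite /= ?mulmx0 ?scale0r //.
  by rewrite dual // eqxx mulr1n scale1r.
rewrite -!mulmxA isotypic_projE (mulmxA _ (isotypic_proj q)) phiP -scalemxAl.
have [->|/eqP dij] := eqVneq (d i) (d j).
  by case: ifP => _; rewrite ?scale1r ?scale0r ?mulmx0.
rewrite commutant_block // scaler0; case: ifP => _; rewrite ?mulmx0 //.
by rewrite commutant_block.
Qed.

Lemma isotypic_proj_commutes q : commutes_sl2 (isotypic_proj q).
Proof.
suff H M : (forall i, chain_hom i i *m M = M *m chain_hom i i) ->
    isotypic_proj q *m M = M *m isotypic_proj q.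
  by split; apply: H => i; have [] := @chain_hom_commutes i i erefl.
by move=> H; rewrite /isotypic_proj mulmx_suml mulmx_sumr; apply: eq_bigr.
Qed.

(** Since P_q commutes with C, the argument is the commutator of P_q B with the
    even operator C, and supertraces of such commutators vanish. *)
Lemma isotypic_trace q (B C : 'M[F]_N) :
    sigma *m C = C *m sigma -> isotypic_proj q *m C = C *m isotypic_proj q ->
  \tr (sigma *m (isotypic_proj q *m (B *m C - C *m B))) = 0.
Proof.
move=> sC PC; rewrite !mulmxBr raddfB /= (mulmxA _ C B) PC.
rewrite -!mulmxA (mulmxA sigma C) sC -(mulmxA C) [X in _ - X]mxtrace_mulC.
by rewrite -!mulmxA subrr.
Qed.

(** Off-diagonal blocks A_ij vanish because the supertraceless even operator
    [eps_j d_j p_i - eps_i d_i p_j] of the commutant acts on them by the scalar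
    [eps_j d_j + eps_i d_i]: this is where equal lengths must have equal
    parities.  On a diagonal block, A sends the lowest vector to a multiple of
    the next one, so A is a multiple of e there; exchanging two chains of the
    same length shows that the multiple depends only on the length. *)
Lemma weight_two_span (A : 'M[F]_N) (Q : seq nat) :
    (forall i j, d i = d j -> par i = par j) ->
    x *m A - A *m x = A -> e *m A = A *m e ->
    (forall Z, commutes_sl2 Z -> sigma *m Z = Z *m sigma ->
       \tr (sigma *m Z) = 0 -> Z *m A = A *m Z) ->
    uniq Q -> (forall i, (1 < d i)%N -> d i \in Q) ->
  exists c : nat -> F, A = \sum_(q <- Q) c q *: (isotypic_proj q *m e).
Proof.
move=> sep xA eA ZA uQ QP.
have dg0 i : (0 < d i)%N := sl2_basis_pos basis i.
have off i j k : i != j -> (k < d i)%N -> phi i k *m (A *m u j 0) = 0.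
  move=> ij ki; pose s i : F := (-1) ^+ par i * (d i)%:R.
  pose Z := s j *: chain_hom i i - s i *: chain_hom j j.
  have cZ : commutes_sl2 Z.
    have [a1 a2 a3] := @chain_hom_commutes i i erefl.
    have [b1 b2 b3] := @chain_hom_commutes j j erefl.
    by split; rewrite mulmxBl mulmxBr -!scalemxAl -!scalemxAr
      ?a1 ?a2 ?a3 ?b1 ?b2 ?b3.
  have sZ : sigma *m Z = Z *m sigma.
    rewrite mulmxBl mulmxBr -!scalemxAl -!scalemxAr.
    by rewrite !chain_hom_parity // !addbb !scale1r.
  have tZ : \tr (sigma *m Z) = 0.
    rewrite mulmxBr -!scalemxAr raddfB /= !mxtraceZ !chain_hom_trace // !eqxx.
    by rewrite -/(s i) -/(s j) mulrC subrr.
  have phiZ : phi i k *m Z = s j *: phi i k.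
    apply: eq_on_basis => i' k' ki'.
    rewrite -mulmxA mulmxBl -!scalemxAl !chain_homE //.
    have [->|ne] := eqVneq i' i.
      by rewrite (negPf ij) scaler0 subr0 -scalemxAr.
    rewrite scaler0 sub0r mulmxN -scalemxAr [in RHS]dual // [i == i']eq_sym (negPf ne).
    rewrite raddf0 scaler0; case: eqP => [<-|_]; last by rewrite mulmx0 scaler0 oppr0.
    by rewrite dual // [i == i']eq_sym (negPf ne) raddf0 scaler0 oppr0.
  have Zu : Z *m u j 0 = - s i *: u j 0.
    rewrite mulmxBl -!scalemxAl !chain_homE // eqxx eq_sym (negPf ij).
    by rewrite scaler0 sub0r scaleNr.
  have : phi i k *m (Z *m (A *m u j 0)) = phi i k *m (A *m (Z *m u j 0)).
    by congr (_ *m _); rewrite !mulmxA ZA.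
  rewrite Zu (mulmxA _ Z) phiZ -!scalemxAr -scalemxAl => /eqP.
  rewrite -subr_eq0 -scalerBl opprK scaler_eq0 => /orP[|/eqP//].
  rewrite /s addrC; have [/sep ->|/eqP dij] := eqVneq (d i) (d j).
    rewrite -mulrDr mulf_eq0 signr_eq0 -natrD pnatr_eq0 addn_eq0.
    by rewrite -[d i == _]negbK -lt0n dg0.
  case: (par i) (par j) => [] []; rewrite ?mulN1r ?mul1r.
  - by rewrite -opprD oppr_eq0 -natrD pnatr_eq0 addn_eq0 -[d i == _]negbK -lt0n dg0.
  - by rewrite addrC subr_eq0 eqr_nat eq_sym => /eqP.
  - by rewrite subr_eq0 eqr_nat => /eqP.
  - by rewrite -natrD pnatr_eq0 addn_eq0 -[d i == _]negbK -lt0n dg0.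
(* A raises weights by one, and only u_(i,1) has the weight above u_(i,0). *)
have /fin_all_exists[c cP] i : exists c : F, A *m u i 0 = c *: u i 1%N.
  exists ((phi i 1%N *m (A *m u i 0)) 0 0); apply: eq_on_dual => j k kj.
  rewrite -scalemxAr; have [ij|ij] := eqVneq i j; last first.
    rewrite off // 1?eq_sym //; have [d1|d1] := leqP (d i) 1.
      by rewrite (u0 d1) mulmx0 scaler0.
    by rewrite dual // eq_sym (negPf ij) raddf0 scaler0.
  rewrite -{j}ij in kj *; have [k1|k1] := eqVneq k 1%N.
    by rewrite k1 in kj *; rewrite [in RHS]dual // !eqxx scalemx1 -mx11_scalar.
  have -> : phi i k *m u i 1%N = 0.
    have [d1|d1] := leqP (d i) 1; first by rewrite (u0 d1) mulmx0.
    by rewrite dual // (negPf k1) andbF raddf0.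
  have phix : phi i k *m x = sl2_weight F (d i) k *: phi i k.
    apply: eq_on_basis => j l lj; rewrite -mulmxA xu -scalemxAl -scalemxAr dual //.
    case: andP => [[/eqP-> /eqP->]//|_].
    by rewrite raddf0 !scaler0.
  rewrite scaler0; have := congr1 (fun M => phi i k *m (M *m u i 0)) xA.
  rewrite mulmxBl mulmxBr -!mulmxA xu (mulmxA _ x) phix -!scalemxAr -scalemxAl.
  move/eqP; rewrite -scalerBl -subr_eq0 -{2}[phi i k *m (A *m u i 0)]scale1r -scalerBl.
  rewrite scaler_eq0 => /orP[|/eqP//]; rewrite /sl2_weight.
  have -> : k%:R - ((d i)%:R - 1) / 2 - (0%:R - ((d i)%:R - 1) / 2) - 1 = k%:R - 1%:R :> F.
    by ring.
  by rewrite subr_eq0 eqr_nat (negPf k1).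
have cu i k : A *m u i k = c i *: u i k.+1.
  elim: k => // k IHk; rewrite -eu mulmxA -eA -mulmxA IHk -scalemxAr.
  by rewrite eu.
have cd i j : d i = d j -> (1 < d i)%N -> c i = c j.
  move=> dij d1; have [->//|ij] := eqVneq i j.
  have TA : chain_hom i j *m A = A *m chain_hom i j.
    apply: ZA; first exact: chain_hom_commutes.
      by rewrite chain_hom_parity // (sep _ _ dij) addbb scale1r.
    by rewrite chain_hom_trace // (negPf ij).
  have := congr1 (fun M => M *m u j 0) TA; rewrite -!mulmxA chain_homE // eqxx.
  rewrite !cu -scalemxAr chain_homE // eqxx => /eqP.
  rewrite -subr_eq0 -scalerBl scaler_eq0 (negPf (basis_neq0 d1)) orbF subr_eq0.
  by move/eqP.
exists (fun q => if [pick i | d i == q] is Some i then c i else 0).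
apply: eq_on_basis => i k ki; rewrite cu mulmx_suml.
have [d1|d1] := leqP (d i) 1.
  have ui : u i k.+1 = 0 by rewrite u0 // (leq_trans d1).
  rewrite ui scaler0 big1 // => q _.
  by rewrite -scalemxAl -mulmxA eu ui mulmx0 scaler0.
rewrite (bigD1_seq (d i)) ?QP //= big1 => [|q qd]; last first.
  by rewrite -scalemxAl -mulmxA eu isotypic_projE eq_sym (negPf qd) scaler0.
rewrite addr0 -scalemxAl -mulmxA eu isotypic_projE eqxx; congr (_ *: _).
case: pickP => [j /eqP jd|/(_ i)]; last by rewrite eqxx.
exact: cd.
Qed.

(** Already the first two vectors of a single chain of length q detect the
    three coefficients attached to q. *)
Lemma isotypic_free (Q : seq nat) (a b c : nat -> F) r :
    uniq Q -> (forall q, q \in Q -> (1 < q)%N /\ exists i, d i = q) ->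
    \sum_(q <- Q) isotypic_proj q *m (a q *: e + b q *: x + c q *: h) = r%:M ->
  forall q, q \in Q -> [/\ a q = 0, b q = 0 & c q = 0].
Proof.
move=> uQ QP sumr q qQ; have [q1 [i di]] := QP q qQ.
have act k : a q *: u i k.+1 + (b q * sl2_weight F q k) *: u i k +
    (c q * sl2_lower F q k) *: u i k.-1 = r *: u i k.
  rewrite -[RHS]mul_scalar_mx -sumr mulmx_suml (bigD1_seq q) //= big1 => [|q' q'q].
    rewrite addr0 -mulmxA !mulmxDl -!scalemxAl eu xu hu !mulmxDr -!scalemxAr.
    by rewrite !isotypic_projE di eqxx !scalerA.
  rewrite -mulmxA !mulmxDl -!scalemxAl eu xu hu !mulmxDr -!scalemxAr.
  by rewrite !isotypic_projE di eq_sym (negPf q'q) !scaler0 !addr0.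
have co k l : (k < q)%N -> phi i k *m u i l = ((k == l) && (l < q)%N)%:R%:M.
  move=> kq; have [lq|lq] := ltnP l q; first by rewrite dual ?di // eqxx andbT.
  by rewrite u0 ?di // mulmx0 andbF raddf0.
have at_ k l : (k < q)%N -> a q * ((k == l.+1) && (l.+1 < q)%N)%:R +
    (b q * sl2_weight F q l) * ((k == l) && (l < q)%N)%:R +
    (c q * sl2_lower F q l) * ((k == l.-1) && (l.-1 < q)%N)%:R =
    r * ((k == l) && (l < q)%N)%:R.
  move=> kq; have /matrixP/(_ 0 0) := congr1 (mulmx (phi i k)) (act l).
  by rewrite !mulmxDr -!scalemxAr !co // !mxE eqxx !mulr1n.
have q0 : (0 < q)%N := ltnW q1.
have a0 : a q = 0.
  by have := at_ 1%N 0%N q1; rewrite /= q1 /sl2_lower !mul0r !mulr0 !addr0 mulr1.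
have c0 : c q = 0.
  have := at_ 0%N 1%N q0; rewrite /= q0 a0 mul0r !mulr0 !add0r mulr1 => /eqP.
  by rewrite mulf_eq0 (negPf (sl2_lower_neq0 _ _)) ?q1 // orbF => /eqP.
split=> //; have := at_ 0%N 0%N q0; have := at_ 1%N 1%N q1.
rewrite /= !q0 !q1 a0 c0 !mul0r !addr0 !add0r !mulr1 => <- /eqP.
rewrite -subr_eq0 -mulrBr sl2_weightS opprD addNKr mulrN1 oppr_eq0.
by move/eqP.
Qed.

End Commutant.

(** * Supermatrices and the parity operator *)

Section Parity.
Variables (F : numClosedFieldType) (m n : nat).
Implicit Types A B : 'M[F]_(m + n).

(** Even and odd matrices are those commuting, resp. anticommuting, with this
    one, which turns all parity conditions into matrix identities. *)
Definition parity_mx : 'M[F]_(m + n) := block_mx 1%:M 0 0 (- 1%:M).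

Lemma supertrace_parity A : supertrace A = \tr (parity_mx *m A).
Proof.
rewrite -{2}[A]submxK /parity_mx mulmx_block !(mul0mx, mul1mx, mulNmx) addr0 add0r.
by rewrite mxtrace_block add0r linearN.
Qed.

Lemma gl_part_parity i A :
  (A \in gl_part F m n i) <-> parity_mx *m A = (-1) ^+ i *: (A *m parity_mx).
Proof.
have pA : parity_mx *m A = block_mx (ulsubmx A) (ursubmx A) (- dlsubmx A) (- drsubmx A).
  rewrite -{1}[A]submxK /parity_mx mulmx_block.
  by rewrite !(mul0mx, mul1mx, mulNmx, addr0, add0r).
have Ap : A *m parity_mx = block_mx (ulsubmx A) (- ursubmx A) (dlsubmx A) (- drsubmx A).
  rewrite -{1}[A]submxK /parity_mx mulmx_block.
  by rewrite !(mulmx0, mulmx1, mulmxN, addr0, add0r).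
rewrite gl_partE pA Ap /gl_comp -[X in _ == X](@block_mx0 F m n m n).
have N2 p q (B : 'M[F]_(p, q)) : B = - B -> B = 0.
  move/eqP; rewrite -subr_eq0 opprK -mulr2n -scaler_nat scaler_eq0 pnatr_eq0 /=.
  by move/eqP.
case: i => /=; rewrite ?expr1 ?expr0 ?scaleN1r ?scale1r ?opp_block_mx ?opprK;
  split=> [/eqP|].
- by case/eq_block_mx=> -> _ _ ->; rewrite !oppr0.
- by case/eq_block_mx=> /N2-> _ _ /esym/N2->.
- by case/eq_block_mx=> _ -> -> _; rewrite !oppr0.
by case/eq_block_mx=> _ /N2-> /esym/N2-> _.
Qed.

#[local] Arguments gl_comp : simpl never.

Lemma gl_br_even A B : A \in gl_part F m n false ->
  gl_br A B = A *m B - B *m A /\ gl_br B A = B *m A - A *m B.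
Proof.
move=> A0; have A1 : gl_comp true A = 0 by move: A0; rewrite gl_partE => /eqP.
rewrite -{2 3 5 6}[B]gl_compD /gl_br !big_bool /= A1 (gl_comp_id A0).
rewrite !(mul0mx, mulmx0, scaler0, subr0, scale1r, addr0, add0r) !mulmxDl !mulmxDr.
by split; rewrite oppr0 add0r [in RHS]opprD [in RHS]addrACA addrC.
Qed.

End Parity.

(** * Passing between sl_(m|n) and g *)

Section SlMatrices.
Variables (F : numClosedFieldType) (m n : nat).

Definition sl_mx (a : sl F m n) : 'M[F]_(m + n) := vsval a.

Fact sl_mx_is_linear : linear sl_mx.
Proof. by move=> c a b; rewrite /sl_mx linearP. Qed.
HB.instance Definition _ :=
  GRing.isLinear.Build F (sl F m n) 'M[F]_(m + n) *:%R sl_mx sl_mx_is_linear.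

Lemma sl_mxD a b : sl_mx (a + b) = sl_mx a + sl_mx b. Proof. exact: linearD. Qed.
Lemma sl_mxZ c a : sl_mx (c *: a) = c *: sl_mx a. Proof. exact: linearZ. Qed.
Lemma sl_mx_sum (J : Type) (r : seq J) (a : J -> sl F m n) :
  sl_mx (\sum_(j <- r) a j) = \sum_(j <- r) sl_mx (a j).
Proof. exact: linear_sum. Qed.

Lemma sl_mx_inj : injective sl_mx.
Proof. exact: val_inj. Qed.

Lemma sl_mx_part i a : (a \in lpart i) = (sl_mx a \in gl_part F m n i).
Proof. exact: sub_partE. Qed.

Lemma sl_mx_lbr a b : sl_mx (lbr a b) = gl_br (sl_mx a) (sl_mx b).
Proof. exact: (sub_brE (@sl_closed F m n)). Qed.

Lemma sl_mx_even a b : a \in lpart false ->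
  sl_mx (lbr a b) = sl_mx a *m sl_mx b - sl_mx b *m sl_mx a /\
  sl_mx (lbr b a) = sl_mx b *m sl_mx a - sl_mx a *m sl_mx b.
Proof. by rewrite sl_mx_part => a0; rewrite !sl_mx_lbr; apply: gl_br_even. Qed.

Definition mx_sl (A : 'M[F]_(m + n)) : sl F m n := vsproj (sl_space F m n) A.

Lemma mx_slK A : A \in sl_space F m n -> sl_mx (mx_sl A) = A.
Proof. exact: vsprojK. Qed.

Lemma sl_scalar_central a b c : sl_mx a = c%:M -> lbr b a = 0.
Proof.
move=> ac; apply: sl_mx_inj; rewrite sl_mx_lbr ac linear0.
have c0 : (c%:M : 'M_(m + n)) \in gl_part F m n false.
  by apply/gl_part_parity; rewrite scale1r scalar_mxC.
by rewrite (gl_br_even _ c0).2 -scalar_mxC subrr.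
Qed.

End SlMatrices.

#[local] Arguments sl_mx : simpl never.

(** What is used of [typeA]: a graded surjection with scalar, hence central,
    kernel. *)
Lemma typeA_spec (F : numClosedFieldType) m n (g : lieSuperalgebra F)
    (pi : 'Hom(sl F m n, g)) : typeA pi ->
  [/\ forall a b, pi (lbr a b) = lbr (pi a) (pi b),
      forall i a, a \in lpart i -> pi a \in lpart i,
      forall i z, z \in lpart i -> exists2 a, a \in lpart i & pi a = z &
      forall a, pi a = 0 -> exists c, sl_mx a = c%:M].
Proof.
move=> hg; case: m n g pi / hg => [m n _|m].
  split=> [a b|i a ai|i z zi|a]; rewrite ?lfunE //; first by exists z; rewrite ?lfunE.
  by move=> a0; exists 0; rewrite (a0 : a = 0) linear0 raddf0.
split=> [a b|i a ai|i z|a].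
- exact: (quo_projM (@sl_scalars_ideall F m) (@sl_scalars_idealr F m)).
- by apply/quo_partP; exists a.
- by case/quo_partP=> a ai ->; exists a.
move/eqP; rewrite quo_proj_eq0 => /vlineP[c ->]; exists c.
by rewrite sl_mxZ /sl_mx vsprojK ?scalar_sl // scalemx1.
Qed.

Lemma jacobi_even (F : numClosedFieldType) (L : lieSuperalgebra F) (a b c : L) :
    a \in lpart false -> b \in lpart false ->
  lbr a (lbr b c) = lbr (lbr a b) c + lbr b (lbr a c).
Proof.
move=> a0 b0; have : c \in (lpart false + lpart true)%VS by rewrite lpartD memvf.
case/memv_addP=> c1 c1p [c2 c2p ->]; rewrite !lbrDr.
rewrite (lbr_jacobi a0 b0 c1p) (lbr_jacobi a0 b0 c2p) !scale1r.
exact: addrACA.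
Qed.

Lemma lbr0l (F : fieldType) (L : lieSuperalgebra F) (a : L) : lbr 0 a = 0.
Proof. exact: (linear0 (lbr_flip a)). Qed.

Section Triples.
Variables (F : numClosedFieldType) (L : lieSuperalgebra F) (e x f : L).

Definition comb3 (a b c : F) : L := a *: e + b *: x + c *: f.

Definition triple_coord (i : 'I_3) (v : L) : F := coord [tuple e; x; f] i v.

Lemma triple_coordE v : v \in lspan3 e x f ->
  v = comb3 (triple_coord 0 v) (triple_coord 1 v) (triple_coord 2 v).
Proof.
move=> vs; rewrite {1}(coord_span (X := [tuple e; x; f]) vs) !big_ord_recl big_ord0.
rewrite /comb3 addr0 addrA; congr (_ *: _ + _ *: _ + _ *: _);
  by rewrite /triple_coord; congr (coord _ _ _); apply: val_inj.
Qed.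

Lemma comb3_span a b c : comb3 a b c \in lspan3 e x f.
Proof. by rewrite /comb3 !memvD ?memvZ // memv_span ?inE ?eqxx ?orbT. Qed.

Hypotheses (e0 : e \in lpart false) (x0 : x \in lpart false) (f0 : f \in lpart false).
Hypothesis triple : sl2_triple e x f.

Lemma triple_coord_comb3 a b c :
  ((triple_coord 0 (comb3 a b c) = a) * (triple_coord 1 (comb3 a b c) = b) *
   (triple_coord 2 (comb3 a b c) = c))%type.
Proof.
have [_ _ _ fr] := triple; pose X := [tuple e; x; f].
have co (i : 'I_3) : triple_coord i (comb3 a b c) =
    a * (0%R == i)%:R + b * (1%R == i)%:R + c * (2%R == i)%:R.
  rewrite /triple_coord -/X /comb3 !linearD !linearZ /=.
  rewrite -[e]/(X`_(0%R : 'I_3)) -[x]/(X`_(1%R : 'I_3)) -[f]/(X`_(2%R : 'I_3)).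
  by rewrite !coord_free.
by do ![split]; rewrite co /= ?mulr1 ?mulr0 ?addr0 ?add0r.
Qed.

Lemma lbr_even_self (v : L) : v \in lpart false -> lbr v v = 0.
Proof.
move=> v0; have /eqP := lbrC v0 v0; rewrite scale1r -subr_eq0 opprK -mulr2n.
by rewrite -scaler_nat scaler_eq0 pnatr_eq0 => /eqP.
Qed.

Lemma lbr_comb3 a b c a' b' c' : lbr (comb3 a b c) (comb3 a' b' c') =
  comb3 (b * a' - a * b') (a * c' - c * a') (c * b' - b * c').
Proof.
have [xe xf ef _] := triple.
have anti (u v : L) : u \in lpart false -> v \in lpart false -> lbr u v = - lbr v u.
  by move=> u0 v0; rewrite (lbrC u0 v0) scale1r.
rewrite /comb3 !lbrDl !lbrDr !lbrZl !lbrZr !lbr_even_self //.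
rewrite [lbr e x]anti // [lbr f x]anti // [lbr f e]anti // xe xf ef.
rewrite !scalerN !scalerA !scaler0 !add0r !addr0 opprK !scalerBl.
by rewrite [LHS](AC (2*2*2) ((3*1)*(2*5)*(6*4))).
Qed.

End Triples.

(** * The multiplicity of the adjoint representation *)

Lemma projector_commutator (R : pzRingType) N (P A Y V : 'M[R]_N) :
    P *m A = A *m P -> P *m Y = Y *m P -> A *m V = V *m A ->
  P *m (Y *m V - V *m Y) = (A *m (P *m V) - (P *m V) *m A) +
                           (Y *m (P *m V) - (P *m V) *m Y).
Proof.
move=> PA PY AV; by rewrite mulmxBr !mulmxA -PA -PY -!mulmxA AV subrr add0r.
Qed.

Section Multiplicity.
Variables (F : numClosedFieldType) (m n : nat) (g : lieSuperalgebra F).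
Variables (pi : 'Hom(sl F m n, g)) (E X H : sl F m n).
Hypothesis typeA_pi : typeA pi.
Hypotheses (E0 : E \in lpart false) (X0 : X \in lpart false) (H0 : H \in lpart false).
Hypothesis triple_lift : sl2_triple E X H.
Let e := pi E.
Let x := pi X.
Let f := pi H.
Hypothesis triple : sl2_triple e x f.
Hypothesis gnat_even : (gnat e x f <= lpart false)%VS.

Local Notation Em := (sl_mx E).
Local Notation Xm := (sl_mx X).
Local Notation Hm := (sl_mx H).

Variables (I : finType) (d : I -> nat) (par : I -> bool).
Variables (u : I -> nat -> 'cV[F]_(m + n)) (phi : I -> nat -> 'rV[F]_(m + n)).
Hypothesis basis : sl2_basis Em Xm Hm d u phi.
Hypothesis parity_u : forall i k, parity_mx F m n *m u i k = (-1) ^+ par i *: u i k.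

Local Notation P q := (isotypic_proj d u phi q).

Let piM a b : pi (lbr a b) = lbr (pi a) (pi b).
Proof. by have [] := typeA_spec typeA_pi. Qed.
Let pi_part i a : a \in lpart i -> pi a \in lpart i.
Proof. by have [_ + _ _] := typeA_spec typeA_pi; apply. Qed.
Let pi_lift i z : z \in lpart i -> exists2 a, a \in lpart i & pi a = z.
Proof. by have [_ _ + _] := typeA_spec typeA_pi; apply. Qed.
Let pi_ker a : pi a = 0 -> exists c, sl_mx a = c%:M.
Proof. by have [_ _ _ +] := typeA_spec typeA_pi; apply. Qed.
Let pi_ker_central a b : pi a = 0 -> lbr b a = 0.
Proof. by case/pi_ker=> c; apply: sl_scalar_central. Qed.
Let pi_surj z : exists a, pi a = z.
Proof.
have : z \in (lpart false + lpart true)%VS by rewrite lpartD memvf.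
case/memv_addP=> _ /pi_lift[a _ <-] [_ /pi_lift[b _ <-] ->].
by exists (a + b); rewrite linearD.
Qed.
Let e0 : e \in lpart false. Proof. exact: pi_part. Qed.
Let x0 : x \in lpart false. Proof. exact: pi_part. Qed.
Let f0 : f \in lpart false. Proof. exact: pi_part. Qed.

Lemma commutes_sl2_lbr z : commutes_sl2 Em Xm Hm (sl_mx z) <->
  [/\ lbr z E = 0, lbr z X = 0 & lbr z H = 0].
Proof.
have sw a : a \in lpart false ->
    (sl_mx z *m sl_mx a = sl_mx a *m sl_mx z) <-> lbr z a = 0.
  move=> a0; have Ea := (sl_mx_even z a0).2.
  split=> [za|za]; last by apply/subr0_eq; rewrite -Ea za linear0.
  by apply: sl_mx_inj; rewrite Ea za subrr linear0.
by split=> [[? ? ?]|[? ? ?]]; split; apply/sw.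
Qed.

Lemma gnatP z : reflect [/\ lbr z e = 0, lbr z x = 0 & lbr z f = 0] (z \in gnat e x f).
Proof.
apply: (iffP (centralizerP _ _)) => [zs|[ze zx zf] y].
  by split; apply: zs; rewrite memv_span // !inE eqxx ?orbT.
by move=> /triple_coordE ->; rewrite !lbrDr !lbrZr ze zx zf !scaler0 !addr0.
Qed.

Lemma commutant_gnat z : commutes_sl2 Em Xm Hm (sl_mx z) -> pi z \in gnat e x f.
Proof.
by case/commutes_sl2_lbr=> zE zX zH; apply/gnatP; rewrite -!piM zE zX zH linear0.
Qed.

(** A lift commutes with the triple up to central elements; bracketing once more
    with the triple, which is its own derived algebra, removes them. *)
Lemma gnat_lift z : z \in gnat e x f ->
  exists a, [/\ a \in lpart false, pi a = z & commutes_sl2 Em Xm Hm (sl_mx a)].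
Proof.
move=> zg; have [a a0 az] := pi_lift (subvP gnat_even z zg).
have /gnatP[ze zx zf] := zg; exists a; split=> //; apply/commutes_sl2_lbr.
have ce b y : pi y = 0 -> lbr b y = 0 := @pi_ker_central y b.
have aE b : b \in lpart false -> lbr z (pi b) = 0 -> forall c,
   c \in lpart false -> lbr (lbr a b) c = 0.
  move=> b0 zb c c0; have ab0 : lbr a b \in lpart false := lbr_part a0 b0.
  by rewrite (lbrC ab0 c0) ce ?scaler0 ?oppr0 // piM az.
have [xe xh eh _] := triple_lift.
have br b c : b \in lpart false -> c \in lpart false ->
    lbr z (pi b) = 0 -> lbr z (pi c) = 0 -> lbr a (lbr b c) = 0.
  by move=> b0 c0 zb zc; rewrite jacobi_even // aE // ce ?addr0 // piM az.
split; first by rewrite -xe br.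
  by rewrite -eh br.
by rewrite -[H]opprK -xh -scaleN1r lbrZr br ?scaler0.
Qed.

(** An isomorphism between an even and an odd chain would be an odd element of
    the centralizer. *)
Lemma equal_length_parity i j : d i = d j -> par i = par j.
Proof.
move=> dij; apply: contraTeq isT => parij; pose T := chain_hom d u phi i j.
have sT : parity_mx F m n *m T = - (T *m parity_mx F m n).
  rewrite (chain_hom_parity basis parity_u dij).
  by case: (par i) (par j) parij => [] [] //= _; rewrite expr1 scaleN1r.
have T1 : T \in gl_part F m n true by apply/gl_part_parity; rewrite expr1 scaleN1r.
have Ts : T \in sl_space F m n by rewrite sl_spaceE (supertrace_odd T1).
have := commutant_gnat; move/(_ (mx_sl T)); rewrite mx_slK //.
move/(_ (chain_hom_commutes basis dij))/(subvP gnat_even) => pT0.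
have pT1 : pi (mx_sl T) \in lpart true.
  by apply: pi_part; rewrite sl_mx_part mx_slK.
have : pi (mx_sl T) \in (lpart false :&: lpart true)%VS.
  by rewrite memv_cap pT0.
rewrite lpartI memv0 => /eqP/pi_ker[c]; rewrite mx_slK // => Tc.
have T0 : T \in gl_part F m n false.
  by apply/gl_part_parity; rewrite Tc scale1r scalar_mxC.
have : T \in (lpart false :&: lpart true : {vspace gl F m n})%VS by rewrite memv_cap T0.
by rewrite lpartI memv0 (negPf (chain_hom_neq0 basis dij)).
Qed.

Let sigma_even a : a \in lpart false ->
  parity_mx F m n *m sl_mx a = sl_mx a *m parity_mx F m n.
Proof. by rewrite sl_mx_part => /gl_part_parity; rewrite scale1r. Qed.

Lemma commutes_sl2_span Z y : commutes_sl2 Em Xm Hm Z -> y \in lspan3 E X H ->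
  Z *m sl_mx y = sl_mx y *m Z.
Proof.
move=> [ZE ZX ZH] /triple_coordE ->; rewrite /comb3 !sl_mxD !sl_mxZ.
by rewrite !mulmxDr !mulmxDl -!scalemxAr -!scalemxAl ZE ZX ZH.
Qed.

Let Prel q : commutes_sl2 Em Xm Hm (P q).
Proof. exact: isotypic_proj_commutes. Qed.

Lemma isotypic_sl q y : y \in lspan3 E X H -> P q *m sl_mx y \in sl_space F m n.
Proof.
have [xe xh eh _] := triple_lift; have [PE PX PH] := Prel q.
have br a b : a \in lpart false -> b \in lpart false ->
    P q *m sl_mx b = sl_mx b *m P q -> P q *m sl_mx (lbr a b) \in sl_space F m n.
  move=> a0 b0 Pb; rewrite sl_spaceE supertrace_parity (sl_mx_even b a0).1.
  by rewrite isotypic_trace ?sigma_even // eqxx.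
move=> /triple_coordE ->.
rewrite /comb3 !sl_mxD !sl_mxZ !mulmxDr -!scalemxAr.
apply: memvD; first apply: memvD; apply: memvZ.
- by rewrite -[E in sl_mx E]xe; apply: br.
- by rewrite -[X in sl_mx X]eh; apply: br.
by rewrite -[H in sl_mx H]opprK -xh -scaleN1r sl_mxZ -scalemxAr memvZ // br.
Qed.

Definition isotypic_lift q y : g := pi (mx_sl (P q *m sl_mx y)).

(** If a is a lift of w, then [X, a] is a lift of [x, w] = w that satisfies the
    relations exactly, and not only up to central elements. *)
Lemma highest_vector_span (Q : seq nat) w :
    uniq Q -> (forall i, (1 < d i)%N -> d i \in Q) ->
    lbr x w = w -> lbr e w = 0 -> (forall z, z \in gnat e x f -> lbr z w = 0) ->
  w \in <<[seq isotypic_lift q E | q <- Q]>>%VS.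
Proof.
move=> uQ QP xw ew zw; have [b bw] := pi_surj w; pose a := lbr X b.
have [xe xh eh _] := triple_lift.
have aw : pi a = w by rewrite piM bw.
have Xa : lbr X a = a.
  apply/subr0_eq; rewrite /a -lbrBr; apply: pi_ker_central.
  by rewrite linearB /= piM bw xw subrr.
have Ea : lbr E a = 0.
  have c0 : lbr X (lbr E a) = 0 by apply: pi_ker_central; rewrite piM aw.
  move: c0; rewrite jacobi_even // xe Xa -mulr2n -scaler_nat => /eqP.
  by rewrite scaler_eq0 pnatr_eq0 => /eqP.
have Za z : z \in lpart false -> commutes_sl2 Em Xm Hm (sl_mx z) -> lbr z a = 0.
  move=> z0 cz; have c0 : lbr X (lbr z a) = 0.
    by apply: pi_ker_central; rewrite piM aw zw // commutant_gnat.
  have [_ zX _] := (commutes_sl2_lbr z).1 cz.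
  have Xz : lbr X z = 0 by rewrite (lbrC X0 z0) zX scaler0 oppr0.
  by move: c0; rewrite jacobi_even // Xz lbr0l add0r Xa.
have [c Ac] : exists c : nat -> F, sl_mx a = \sum_(q <- Q) c q *: (P q *m Em).
  apply: (weight_two_span basis parity_u) => //.
  - exact: equal_length_parity.
  - by rewrite -(sl_mx_even a X0).1 Xa.
  - by apply/subr0_eq; rewrite -(sl_mx_even a E0).1 Ea linear0.
  move=> Z cZ sZ trZ; have Zs : Z \in sl_space F m n.
    by rewrite sl_spaceE supertrace_parity trZ.
  rewrite -(mx_slK Zs) in cZ *.
  have Z0 : mx_sl Z \in lpart false.
    by rewrite sl_mx_part mx_slK //; apply/gl_part_parity; rewrite scale1r.
  by apply/subr0_eq; rewrite -(sl_mx_even a Z0).1 (Za _ Z0 cZ) linear0.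
have -> : w = \sum_(q <- Q) c q *: isotypic_lift q E.
  rewrite -aw (_ : a = \sum_(q <- Q) c q *: mx_sl (P q *m Em)).
    by rewrite linear_sum; apply: eq_bigr => q _; rewrite linearZ.
  apply: sl_mx_inj; rewrite Ac sl_mx_sum; apply: eq_bigr => q _.
  rewrite sl_mxZ mx_slK // isotypic_sl //.
  by rewrite memv_span // inE eqxx.
rewrite big_seq; apply: memv_suml => q qQ.
by rewrite memvZ // memv_span //; apply/mapP; exists q.
Qed.

Definition lift_span (v : g) : sl F m n :=
  comb3 E X H (triple_coord e x f 0 v) (triple_coord e x f 1 v) (triple_coord e x f 2 v).

Lemma lift_span_linear : linear lift_span.
Proof.
move=> c v w; rewrite /lift_span /comb3 /triple_coord !linearP /=.
rewrite !scalerDl !scalerDr !scalerA -!addrA; congr (_ + _).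
rewrite addrCA; congr (_ + _); rewrite [RHS]addrCA; congr (_ + _).
exact: addrCA.
Qed.

Lemma lift_span_even v : lift_span v \in lpart false.
Proof. by rewrite /lift_span /comb3 !memvD ?memvZ. Qed.

Lemma lift_spanK v : v \in lspan3 e x f -> pi (lift_span v) = v.
Proof. by move/triple_coordE=> {2}->; rewrite /lift_span /comb3 !linearD !linearZ. Qed.

Lemma lift_span_lbr y v : y \in lspan3 e x f -> v \in lspan3 e x f ->
  lift_span (lbr y v) = lbr (lift_span y) (lift_span v).
Proof.
move=> /triple_coordE yE /triple_coordE vE.
rewrite [in RHS]/lift_span (lbr_comb3 E0 X0 H0 triple_lift).
rewrite {1}yE {1}vE (lbr_comb3 e0 x0 f0 triple) /lift_span.
by rewrite !(triple_coord_comb3 triple).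
Qed.

Lemma isotypic_liftE q y : y \in lspan3 E X H ->
  sl_mx (mx_sl (P q *m sl_mx y)) = P q *m sl_mx y.
Proof. by move=> ys; rewrite mx_slK ?isotypic_sl. Qed.

(** The copies of the triple are the maps y |-> P_q y for q in Q. *)
Lemma isotypic_embedding (Q : seq nat) :
    uniq Q -> (forall q, q \in Q -> (1 < q)%N /\ exists i, d i = q) ->
  power_embeds (@triv_adj_action F g e x f) (@g_action F g e x f) (size Q).
Proof.
move=> uQ QP; pose S := subvs_of (lspan3 e x f).
pose psi (v : {ffun 'I_(size Q) -> S}) : g :=
  \sum_(k < size Q) isotypic_lift (nth 0%N Q k) (lift_span (vsval (v k))).
have psi_lin : linear psi.
  move=> c v w; rewrite /psi scaler_sumr -big_split; apply: eq_bigr => k _ /=.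
  rewrite !ffunE linearP /= lift_span_linear /isotypic_lift sl_mxD sl_mxZ.
  by rewrite mulmxDr -scalemxAr /mx_sl !linearP.
pose psiL : {linear {ffun 'I_(size Q) -> S} -> g} :=
  HB.pack psi (GRing.isLinear.Build _ _ _ _ psi psi_lin).
have ls v : lift_span v \in lspan3 E X H by apply: comb3_span.
exists (linfun psiL); split.
  move=> [z y] v; rewrite !lfunE /= /psi /g_action /=.
  have zg : vsval z \in gnat e x f by apply: subvsP.
  have ys : vsval y \in lspan3 e x f by apply: subvsP.
  have [a [a0 az ca]] := gnat_lift zg.
  rewrite linear_sum; apply: eq_bigr => k _; rewrite ffunE.
  set q := nth 0%N Q k; have vs : vsval (v k) \in lspan3 e x f by apply: subvsP.
  have yvs : lbr (vsval y) (vsval (v k)) \in lspan3 e x f.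
    move: ys vs => /triple_coordE-> /triple_coordE->.
    by rewrite (lbr_comb3 e0 x0 f0 triple) comb3_span.
  rewrite /triv_adj_action /= vsprojK // lift_span_lbr //.
  rewrite -az -{2}(lift_spanK ys) -linearD -piM; congr (pi _).
  have br_s : lbr (lift_span (vsval y)) (lift_span (vsval (v k))) \in lspan3 E X H.
    by rewrite -lift_span_lbr.
  have Eb := isotypic_liftE q (ls (vsval (v k))).
  set b := mx_sl _ in Eb *.
  apply: sl_mx_inj; rewrite (isotypic_liftE q br_s) (lbrDl a) [in RHS]sl_mxD.
  rewrite (sl_mx_even b a0).1 (sl_mx_even b (lift_span_even (vsval y))).1 Eb.
  rewrite (sl_mx_even _ (lift_span_even (vsval y))).1.
  apply: projector_commutator.
  - exact: (isotypic_proj_central basis q ca).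
  - exact: (commutes_sl2_span (Prel q) (ls (vsval y))).
  exact: (commutes_sl2_span ca (ls _)).
apply/eqP; rewrite -subv0; apply/subvP=> v; rewrite memv_ker lfunE /= /psi => /eqP.
rewrite -linear_sum => /pi_ker[r]; rewrite sl_mx_sum => rE.
pose co j q := if insub (index q Q) is Some k then triple_coord e x f j (vsval (v k)) else 0.
have coE j (k : 'I_(size Q)) : co j (nth 0%N Q k) = triple_coord e x f j (vsval (v k)).
  by rewrite /co index_uniq // valK.
have free_Q := isotypic_free basis (a := co 0) (b := co 1) (c := co 2) (r := r) uQ QP.
have v0 k : vsval (v k) = 0.
  have vs : vsval (v k) \in lspan3 e x f by apply: subvsP.
  have [|c0 c1 c2] := free_Q _ _ (mem_nth 0%N (ltn_ord k)).
    rewrite (big_nth 0%N) big_mkord -rE; apply: eq_bigr => j _.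
    by rewrite isotypic_liftE // /lift_span /comb3 !sl_mxD !sl_mxZ !coE.
  by rewrite (triple_coordE vs) -!coE c0 c1 c2 /comb3 !scale0r !addr0.
by rewrite memv0; apply/eqP/ffunP=> k; apply: val_inj; rewrite ffunE /= v0.
Qed.

(** A copy of S^k is determined by the images of e, which are highest weight
    vectors. *)
Lemma embedding_bound (Q : seq nat) k :
    uniq Q -> (forall i, (1 < d i)%N -> d i \in Q) ->
    power_embeds (@triv_adj_action F g e x f) (@g_action F g e x f) k ->
  (k <= size Q)%N /\ (k <= \dim {:g})%N.
Proof.
move=> uQ QP [emb [hom inj]]; pose S := subvs_of (lspan3 e x f).
have es : e \in lspan3 e x f by rewrite memv_span // !inE eqxx.
have xs : x \in lspan3 e x f by rewrite memv_span // !inE eqxx orbT.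
pose s_e : S := vsproj _ e.
pose psi (c : 'rV[F]_k) : g := emb [ffun j => c 0 j *: s_e].
have psi_lin : linear psi.
  move=> a c c'; rewrite /psi -linearP; congr (emb _); apply/ffunP=> j.
  by rewrite !ffunE !mxE scalerDl scalerA.
pose psiL : {linear 'rV[F]_k -> g} :=
  HB.pack psi (GRing.isLinear.Build _ _ _ _ psi psi_lin).
have inj_psi : lker (linfun psiL) == 0%VS.
  rewrite -subv0; apply/subvP=> c; rewrite memv_ker lfunE /= /psi.
  rewrite -memv_ker inj !memv0 => /eqP c0; apply/eqP/rowP=> j; rewrite mxE.
  have /ffunP/(_ j)/eqP := c0; rewrite !ffunE scaler_eq0 => /orP[/eqP//|/eqP se0].
  have [_ _ _ /free_not0/(_ (mem_head _ _))/negP[]] := triple.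
  by rewrite -[e](vsprojK es) -/s_e se0 linear0.
have dim_psi : \dim (limg (linfun psiL)) = k.
  by rewrite limg_dim_eq ?(eqP inj_psi) ?capv0 // dimvf /dim /= mul1n.
split; last by rewrite -{1}dim_psi dimvS ?subvf.
rewrite -{1}dim_psi -(size_map (fun q => isotypic_lift q E) Q).
apply: leq_trans (dim_span _); apply: dimvS; apply/subvP=> _ /memv_imgP[c _ ->].
rewrite lfunE /=; have [xe xf ef _] := triple.
pose v : {ffun 'I_k -> S} := [ffun j => c 0 j *: s_e].
have act z y r : z \in gnat e x f -> y \in lspan3 e x f -> lbr y e = r *: e ->
    lbr (z + y) (psi c) = r *: psi c.
  move=> zg ys ye; pose a : gnat_s e x f := (vsproj _ z, vsproj _ y).
  have := hom a v; rewrite /g_action /= !vsprojK // => <-.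
  rewrite /psi -linearZ; congr (emb _); apply/ffunP=> j; rewrite !ffunE.
  apply: val_inj; rewrite /triv_adj_action /= !linearZ /= !vsprojK // ye.
    by rewrite !scalerA mulrC.
  exact: memvZ.
apply: highest_vector_span => //.
- by rewrite -[x]add0r (act _ _ 1) ?mem0v ?scale1r.
- by rewrite -[e]add0r (act _ _ 0) ?mem0v ?scale0r // lbr_even_self.
by move=> z zg; rewrite -[z]addr0 (act _ _ 0) ?mem0v ?scale0r // lbr0l.
Qed.

Lemma mult_triv_adjE (Q : seq nat) : uniq Q ->
    (forall q, q \in Q <-> (1 < q)%N /\ exists i, d i = q) ->
  mult_triv_adj e x f = size Q.
Proof.
move=> uQ QP; have dQ i : (1 < d i)%N -> d i \in Q.
  by move=> d1; apply/QP; split=> //; exists i.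
have embQ := isotypic_embedding uQ (fun q => (QP q).1).
have [_ lt_dim] := embedding_bound uQ dQ embQ.
apply/eqP; rewrite eqn_leq; apply/andP; split.
  by apply/bigmax_leqP=> k /asboolP /(embedding_bound uQ dQ) [].
have ltQ : (size Q < (\dim {:g}).+1)%N by rewrite ltnS.
by apply: (bigmax_sup (Ordinal ltQ)) => //; apply/asboolP.
Qed.

End Multiplicity.

(** * Encodings *)

Section Encoding.
Variables (F : numClosedFieldType) (m n : nat).

Lemma even_block (a : sl F m n) : a \in lpart false ->
  sl_mx a = block_mx (ulsubmx (sl_mx a)) 0 0 (drsubmx (sl_mx a)).
Proof. by rewrite sl_mx_part => /gl_comp_id {1}<-. Qed.

Lemma block_sl2_relations (E X H : sl F m n) :
    E \in lpart false -> X \in lpart false -> H \in lpart false ->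
    sl2_triple E X H ->
  sl2_relations (ulsubmx (sl_mx E)) (ulsubmx (sl_mx X)) (ulsubmx (sl_mx H)) /\
  sl2_relations (drsubmx (sl_mx E)) (drsubmx (sl_mx X)) (drsubmx (sl_mx H)).
Proof.
move=> E0 X0 H0 [xe xh eh _].
have br (a b c : sl F m n) : a \in lpart false -> b \in lpart false ->
    c \in lpart false -> lbr a b = c ->
    (ulsubmx (sl_mx a) *m ulsubmx (sl_mx b) - ulsubmx (sl_mx b) *m ulsubmx (sl_mx a)
      = ulsubmx (sl_mx c)) /\
    (drsubmx (sl_mx a) *m drsubmx (sl_mx b) - drsubmx (sl_mx b) *m drsubmx (sl_mx a)
      = drsubmx (sl_mx c)).
  move=> a0 b0 c0 /(congr1 (@sl_mx F m n)); rewrite (sl_mx_even b a0).1.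
  rewrite {1 2}(even_block a0) {1 2}(even_block b0) {1}(even_block c0).
  rewrite !mulmx_block !(mul0mx, mulmx0, addr0, add0r) opp_block_mx add_block_mx.
  by case/eq_block_mx.
have [e1 e2] := br _ _ _ X0 E0 E0 xe; have [x1 x2] := br _ _ _ E0 H0 X0 eh.
have H0' : - H \in lpart false by rewrite memvN.
have [h1 h2] := br _ _ _ X0 H0 H0' xh.
have sN : sl_mx (- H) = - sl_mx H by rewrite -scaleN1r sl_mxZ scaleN1r.
by split; split=> //; rewrite ?h1 ?h2 sN; apply/matrixP=> i j; rewrite !mxE.
Qed.

Lemma diag_submx_comb b c d (A B C : 'M[F]_(m + n)) :
  (ulsubmx (b *: A + c *: B + d *: C) =
     b *: ulsubmx A + c *: ulsubmx B + d *: ulsubmx C) /\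
  (drsubmx (b *: A + c *: B + d *: C) =
     b *: drsubmx A + c *: drsubmx B + d *: drsubmx C).
Proof. by split; apply/matrixP=> i j; rewrite !mxE. Qed.

Theorem encoded_multiplicity (g : lieSuperalgebra F) (pi : 'Hom(sl F m n, g))
    (e x f : g) (alpha beta : seq nat) :
    typeA pi -> sl2_triple e x f -> (gnat e x f <= lpart false)%VS ->
    encoded pi e x f alpha beta ->
  mult_triv_adj e x f = size (undup [seq q <- alpha ++ beta | (1 < q)%N]) /\
  (forall q, q \in alpha -> q \notin beta).
Proof.
move=> tA triple gn [E [X [H [[E0 X0 H0] tri [piE piX piH] decA decB]]]].
have [relA relB] := block_sl2_relations E0 X0 H0 tri.
have Es : E \in lspan3 E X H by rewrite memv_span // !inE eqxx.
have Xs : X \in lspan3 E X H by rewrite memv_span // !inE eqxx orbT.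
have Hs : H \in lspan3 E X H by rewrite memv_span // !inE eqxx !orbT.
have actP (y : sl F m n) : y \in lspan3 E X H ->
    exists a : subvs_of (lspan3 E X H), vsval a = y.
  by move=> ys; exists (vsproj _ y); rewrite vsprojK.
have actE (a : subvs_of (lspan3 E X H)) : exists b c d,
    sl_mx (vsval a) = b *: sl_mx E + c *: sl_mx X + d *: sl_mx H.
  have /triple_coordE -> := subvsP a; rewrite /comb3 !sl_mxD !sl_mxZ.
  by do 3 eexists.
have [u [phi basA]] : exists u phi, sl2_basis (ulsubmx (sl_mx E)) (ulsubmx (sl_mx X))
    (ulsubmx (sl_mx H)) (fun i : 'I_(size alpha) => nth 0%N alpha i) u phi.
  apply: (decomposes_sl2_basis relA) decA.
  - by have [a aE] := actP E Es; exists a => v; rewrite /even_action aE.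
  - by have [a aE] := actP X Xs; exists a => v; rewrite /even_action aE.
  - by have [a aE] := actP H Hs; exists a => v; rewrite /even_action aE.
  move=> a; have [b [c [d abc]]] := actE a; exists b, c, d => v.
  by rewrite /even_action -/(sl_mx (vsval a)) abc (diag_submx_comb _ _ _ _ _ _).1
    !mulmxDl -!scalemxAl.
have [u' [phi' basB]] : exists u phi, sl2_basis (drsubmx (sl_mx E)) (drsubmx (sl_mx X))
    (drsubmx (sl_mx H)) (fun i : 'I_(size beta) => nth 0%N beta i) u phi.
  apply: (decomposes_sl2_basis relB) decB.
  - by have [a aE] := actP E Es; exists a => v; rewrite /odd_action aE.
  - by have [a aE] := actP X Xs; exists a => v; rewrite /odd_action aE.
  - by have [a aE] := actP H Hs; exists a => v; rewrite /odd_action aE.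
  move=> a; have [b [c [d abc]]] := actE a; exists b, c, d => v.
  by rewrite /odd_action -/(sl_mx (vsval a)) abc (diag_submx_comb _ _ _ _ _ _).2
    !mulmxDl -!scalemxAl.
have bas := sl2_basis_sum basA basB.
rewrite -!even_block // in bas.
pose par (i : 'I_(size alpha) + 'I_(size beta)) := if i is inr _ then true else false.
set d := (d in sl2_basis _ _ _ d _ _) in bas.
set uu := (u in sl2_basis _ _ _ _ u _) in bas.
have parity_uu i k : parity_mx F m n *m uu i k = (-1) ^+ par i *: uu i k.
  case: i => a; rewrite /uu /parity_mx mul_block_col /= ?scale1r ?scaleN1r.
    by rewrite !(mul0mx, mulmx0, mul1mx, addr0).
  by rewrite !(mul0mx, mulmx0, mulNmx, mul1mx, addr0, add0r) opp_col_mx oppr0.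
subst e x f; split; last first.
  move=> q /(nthP 0%N)[i ia iq]; apply/negP=> /(nthP 0%N)[j jb jq].
  have := equal_length_parity tA E0 X0 H0 gn bas parity_uu
    (i := inl (Ordinal ia)) (j := inr (Ordinal jb)).
  by rewrite /= iq jq => /(_ erefl).
apply: (mult_triv_adjE tA E0 X0 H0 tri triple gn bas parity_uu (undup_uniq _)) => q.
rewrite mem_undup mem_filter mem_cat; split=> [/andP[q1 /orP[]]|[q1 [[i|j] dq]]].
- by move=> /(nthP 0%N)[i ia iq]; split=> //; exists (inl (Ordinal ia)).
- by move=> /(nthP 0%N)[i ia iq]; split=> //; exists (inr (Ordinal ia)).
- by rewrite q1 -dq (mem_nth 0%N (ltn_ord i)).
by rewrite q1 -dq (mem_nth 0%N (ltn_ord j)) orbT.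
Qed.

End Encoding.

(** * Partitions *)

Section Rearrangement.
Variables (F : fieldType) (A : Type) (V : vectType F) (rho : A -> V -> V).

Lemma perm_decomposes (ds ds' : seq nat) :
  perm_eq ds ds' -> decomposes rho ds -> decomposes rho ds'.
Proof.
move=> pds [U [sumU dxU irrU]].
have /tuple_permP[p dsE] : perm_eq ds' (in_tuple ds) by rewrite perm_sym.
have sz : size ds' = size ds by rewrite (perm_size pds).
pose h (i : 'I_(size ds')) : 'I_(size ds) := p (cast_ord sz i).
have h_bij : bijective h.
  exists (fun j => cast_ord (esym sz) ((p^-1)%g j)) => i; rewrite /h.
    by rewrite permK cast_ordK.
  by rewrite cast_ordKV permKV.
have hE i : nth 0%N ds (h i) = nth 0%N ds' i.
  rewrite [RHS](congr1 (fun s => nth 0%N s i) dsE) -[nat_of_ord i]/(nat_of_ord (cast_ord sz i)).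
  by rewrite -tnth_nth tnth_mktuple (tnth_nth 0%N).
have sum_h : (\sum_i U (h i) = fullv)%VS by rewrite -sumU [RHS](reindex h) //; apply: onW_bij.
exists (fun i => U (h i)); split=> // [|i]; last by have [irr dimU] := irrU (h i); rewrite -hE.
move: dxU; rewrite !directvE /= sumU sum_h => /eqP ->; apply/eqP.
by rewrite (reindex h) //; apply: onW_bij.
Qed.

End Rearrangement.

Lemma perm_two_values q r (s : seq nat) : q != r -> {subset s <= [:: q; r]} ->
  perm_eq s (nseq (count_mem q s) q ++ nseq (count_mem r s) r).
Proof.
move=> qr sub; apply/seq.permP=> a; rewrite count_cat !count_nseq.
elim: s sub => [|y s IHs] sub; first by rewrite !muln0.
rewrite /= IHs => [|z zs]; last by apply: sub; rewrite inE zs orbT.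
have := sub y (mem_head _ _); rewrite !inE => /orP[] /eqP ->.
  by rewrite eqxx (negPf qr) add1n add0n mulnS addnA.
by rewrite eqxx eq_sym (negPf qr) add1n add0n mulnS addnCA.
Qed.

Lemma encoded_perm (F : fieldType) m n (g : lieSuperalgebra F)
    (pi : 'Hom(sl F m n, g)) e x f alpha beta alpha' beta' :
    perm_eq alpha alpha' -> perm_eq beta beta' ->
  encoded pi e x f alpha beta -> encoded pi e x f alpha' beta'.
Proof.
move=> pa pb [E [X [H [ev tri piE dA dB]]]]; exists E, X, H; split=> //.
  exact: perm_decomposes dA.
exact: perm_decomposes dB.
Qed.

Lemma mem_partition_of t (p k : 'I_t -> nat) q :
  reflect (exists2 i, (0 < k i)%N & p i = q) (q \in partition_of p k).
Proof.
apply: (iffP flatten_mapP) => [[i _]|[i ki <-]].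
  by rewrite mem_nseq => /andP[ki /eqP ->]; exists i.
by exists i; rewrite ?mem_enum // mem_nseq ki eqxx.
Qed.

Lemma sumn_partition_of t (p k : 'I_t -> nat) :
  sumn (partition_of p k) = (\sum_i k i * p i)%N.
Proof.
rewrite /partition_of sumn_flatten -map_comp sumnE big_map big_enum /=.
by apply: eq_bigr => i _; rewrite sumn_nseq mulnC.
Qed.

Lemma card_large_parts t (p mu nu : 'I_t -> nat) :
    injective p -> (forall i, (0 < mu i + nu i)%N) ->
  size (undup [seq q <- partition_of p mu ++ partition_of p nu | (1 < q)%N]) =
  #|[set i | (1 < p i)%N]|.
Proof.
move=> pinj munu; rewrite cardE -(size_map p); apply/perm_size/uniq_perm.
- exact: undup_uniq.
- by rewrite map_inj_uniq // enum_uniq.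
move=> q; rewrite mem_undup mem_filter mem_cat; apply/andP/mapP => [[q1 qp]|[j]].
  have [i piq] : exists i, p i = q.
    by case/orP: qp => /mem_partition_of[i _ piq]; exists i.
  by exists i; rewrite // mem_enum inE piq.
rewrite mem_enum inE => pj1 ->; split=> //; apply/orP.
have := munu j; rewrite addn_gt0 => /orP[k0|k0]; [left|right];
  by apply/mem_partition_of; exists j.
Qed.

Lemma size_large_eq1 q (s : seq nat) :
    (1 < q)%N -> q \in s -> {subset s <= [:: q; 1%N]} ->
  size (undup [seq z <- s | (1 < z)%N]) = 1%N.
Proof.
move=> q1 qs sub; rewrite -[RHS]/(size [:: q]).
apply/perm_size/uniq_perm; rewrite ?undup_uniq //= => z.
rewrite mem_undup mem_filter inE; apply/andP/eqP => [[z1 /sub]|->] //.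
by rewrite !inE => /orP[/eqP//|/eqP z1E]; rewrite z1E in z1.
Qed.

Lemma size_large_eq1_inv (s : seq nat) :
    (forall z, z \in s -> (0 < z)%N) ->
    size (undup [seq z <- s | (1 < z)%N]) = 1%N ->
  exists q, [/\ (1 < q)%N, q \in s & {subset s <= [:: q; 1%N]}].
Proof.
move=> pos; set Q := undup _ => sQ.
have [q Qq] : exists q, Q = [:: q] by case: Q sQ => [|q []] //; exists q.
have memQ z : (z \in s) && (1 < z)%N = (z == q).
  by rewrite -[RHS](mem_seq1 z q) -Qq mem_undup mem_filter andbC.
have /andP[qs q1] : (q \in s) && (1 < q)%N by rewrite memQ.
exists q; split=> // z zs; rewrite !inE -memQ zs /=.
by have := pos z zs; case: z {zs} => [|[]].
Qed.

Lemma eq_nseq1 (s : seq nat) : {subset s <= [:: 1%N]} -> s = nseq (sumn s) 1%N.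
Proof.
move=> sub; have /all_pred1P E : all (pred1 1%N) s.
  by apply/allP=> z /sub; rewrite inE.
by rewrite {2}E sumn_nseq mul1n.
Qed.

(** If q lies on one side, the other side consists of ones only, because no part
    occurs on both sides; and if there are ones next to q, then for the same
    reason the other side is empty. *)
Lemma encoding_shapes (F : fieldType) m n (g : lieSuperalgebra F)
    (pi : 'Hom(sl F m n, g)) e x f alpha beta q :
    encoded pi e x f alpha beta -> sumn alpha = m -> sumn beta = n ->
    (forall z, z \in alpha -> z \notin beta) ->
    (1 < q)%N -> {subset alpha ++ beta <= [:: q; 1%N]} ->
  (q \in alpha ->
     (exists r, [/\ m = (q * count_mem q alpha + r)%N, n = 0%N &
        encoded pi e x f (nseq (count_mem q alpha) q ++ nseq r 1%N) [::]]) \/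
     (m = (q * count_mem q alpha)%N /\
        encoded pi e x f (nseq (count_mem q alpha) q) (nseq n 1%N))) /\
  (q \in beta ->
     (exists r, [/\ n = (q * count_mem q beta + r)%N, m = 0%N &
        encoded pi e x f [::] (nseq (count_mem q beta) q ++ nseq r 1%N)]) \/
     (n = (q * count_mem q beta)%N /\
        encoded pi e x f (nseq m 1%N) (nseq (count_mem q beta) q))).
Proof.
move=> enc sa sb dis q1 sub.
have suba : {subset alpha <= [:: q; 1%N]} by move=> z za; rewrite sub ?mem_cat ?za.
have subb : {subset beta <= [:: q; 1%N]} by move=> z zb; rewrite sub ?mem_cat ?zb ?orbT.
have qn1 : q != 1%N by rewrite neq_ltn q1 orbT.
have sumE (s : seq nat) : {subset s <= [:: q; 1%N]} ->
    sumn s = (q * count_mem q s + count_mem 1%N s)%N.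
  move=> ss; rewrite (perm_sumn (perm_two_values qn1 ss)) sumn_cat !sumn_nseq.
  by rewrite mul1n.
have only1 (s : seq nat) : {subset s <= [:: q; 1%N]} -> q \notin s -> {subset s <= [:: 1%N]}.
  move=> ss qs z zs; have := ss z zs; rewrite !inE => /orP[/eqP zq|//].
  by rewrite zq (negPf qs) in zs.
have pa := perm_two_values qn1 suba; have pb := perm_two_values qn1 subb.
split=> [qa|qb].
  have b1 := eq_nseq1 (only1 _ subb (dis q qa)).
  have [a1|a1] := boolP (1%N \in alpha); [left|right].
    have b0 : beta = [::].
      by move: b1 (dis _ a1) => ->; rewrite mem_nseq eqxx andbT -eqn0Ngt => /eqP ->.
    exists (count_mem 1%N alpha); split; rewrite -?sa -?sb ?b0 //; first exact: sumE.
    by rewrite -b0; apply: encoded_perm enc.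
  have c0 : count_mem 1%N alpha = 0%N by apply/count_memPn.
  split; first by rewrite -sa sumE // c0 addn0.
  by apply: encoded_perm enc; [rewrite c0 cats0 in pa | rewrite -sb -b1].
have qa : q \notin alpha by apply/negP=> /dis; rewrite qb.
have a1 := eq_nseq1 (only1 _ suba qa).
have [b1|b1] := boolP (1%N \in beta); [left|right].
  have a0 : alpha = [::].
    have : 1%N \notin alpha by apply/negP=> /dis; rewrite b1.
    by rewrite a1 mem_nseq eqxx andbT -eqn0Ngt => /eqP ->.
  exists (count_mem 1%N beta); split; rewrite -?sa -?sb ?a0 //; first exact: sumE.
  by rewrite -a0; apply: encoded_perm enc.
have c0 : count_mem 1%N beta = 0%N by apply/count_memPn.
split; first by rewrite -sb sumE // c0 addn0.
by apply: encoded_perm enc; [rewrite -sa -a1 | rewrite c0 cats0 in pb].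
Qed.

Theorem proposition4p1 (R : realType) (m n : nat)
    (g : lieSuperalgebra R[i]) (pi : 'Hom(sl R[i] m n, g))
    (hg : typeA pi)
    (e x f : g)
    (hf : f \in lpart false) (hnil : ad_nilpotent f)
    (he : e \in lpart false) (hx : x \in lpart false)
    (htriple : sl2_triple e x f)
    (t : nat) (p mu nu : 'I_t -> nat)
    (hinj : injective p) (hp : forall i, (0 < p i)%N)
    (hmunu : forall i, (0 < mu i + nu i)%N)
    (hm : (\sum_i mu i * p i)%N = m) (hn : (\sum_i nu i * p i)%N = n)
    (hencoded : encoded pi e x f (partition_of p mu) (partition_of p nu))
    (hred : reductive_lie_algebra (gnat e x f)) :
  mult_triv_adj e x f = #|[set i | (1 < p i)%N]| /\
  (mult_triv_adj e x f = 1%N <->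
   exists q l : nat, [/\ (1 < q)%N, (0 < l)%N &
     [\/ (exists r : nat,
            [/\ m = (q * l + r)%N, n = 0%N &
                encoded pi e x f (nseq l q ++ nseq r 1%N) [::]]),
         (exists r : nat,
            [/\ n = (q * l + r)%N, m = 0%N &
                encoded pi e x f [::] (nseq l q ++ nseq r 1%N)]),
         (m = (q * l)%N /\ encoded pi e x f (nseq l q) (nseq n 1%N)) |
         (n = (q * l)%N /\ encoded pi e x f (nseq m 1%N) (nseq l q))]]).
Proof.
have mult alpha beta := @encoded_multiplicity _ m n g pi e x f alpha beta hg htriple hred.1.
have [multE dis] := mult _ _ hencoded; split; first by rewrite multE card_large_parts.
split=> [mult1|[q [l [q1 l0 shape]]]].
  have pos z : z \in partition_of p mu ++ partition_of p nu -> (0 < z)%N.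
    by rewrite mem_cat => /orP[] /mem_partition_of[i _ <-].
  have [|q [q1 qs sub]] := size_large_eq1_inv pos; first by rewrite -multE.
  have [shapeA shapeB] := encoding_shapes hencoded (etrans (sumn_partition_of _ _) hm)
    (etrans (sumn_partition_of _ _) hn) dis q1 sub.
  move: qs; rewrite mem_cat => /orP[qa|qb]; exists q.
    exists (count_mem q (partition_of p mu)); rewrite -has_count has_pred1 qa.
    by case: (shapeA qa) => [?|?]; split=> //; [apply: Or41 | apply: Or43].
  exists (count_mem q (partition_of p nu)); rewrite -has_count has_pred1 qb.
  by case: (shapeB qb) => [?|?]; split=> //; [apply: Or42 | apply: Or44].
have main alpha beta : encoded pi e x f alpha beta -> q \in alpha ++ beta ->
    {subset alpha ++ beta <= [:: q; 1%N]} -> mult_triv_adj e x f = 1%N.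
  by move=> /mult[-> _] qs sub; apply: size_large_eq1 qs sub.
have sub_nseq a b : {subset nseq a q ++ nseq b 1%N <= [:: q; 1%N]}.
  move=> z; rewrite mem_cat !mem_nseq !inE.
  by case/orP=> /andP[_ ->]; rewrite ?orbT.
have mem_q a : q \in nseq l q ++ a by rewrite mem_cat mem_nseq l0 eqxx.
case: shape => [[r [_ _ enc]]|[r [_ _ enc]]|[_ enc]|[_ enc]]; apply: (main _ _ enc).
- by rewrite cats0 mem_q.
- by rewrite cats0; apply: sub_nseq.
- exact: mem_q.
- exact: sub_nseq.
- exact: mem_q.
- exact: sub_nseq.
- by rewrite mem_cat orbC -mem_cat mem_q.
by move=> z; rewrite mem_cat orbC -mem_cat; apply: sub_nseq.
Qed.
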